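(* Let $V\subset H\subset V'$, $A$ and $F$ be as in the context, and let $G$ be the strict m-semiflow generated by the mild solutions of $\frac{dy}{dt}+Ay\in F(y)$. Assume that there is a sequence of maps $F_N:H\to\mathcal{P}(H)$, $N\ge1$, with closed, convex, bounded values such that $$F(y)\subset F_N(y)\quad\text{for all } y\in H,\ N\ge 1,$$ $$\mathrm{dist}(F_N(y),F(y))\to 0\ \text{ as } N\to\infty,\quad\text{for all } y\in H,$$ $$\mathrm{dist}_H(F_N(y_1),F_N(y_2))\le c_N\|y_1-y_2\|\quad\text{for all } y_1,y_2\in H,$$ for some constants $c_N>0$. Let $B\subset H$ be a compact, connected, quasi-invariant set which is chain recurrent with respect to $G$, and assume that $A\in\mathcal{L}(H)$ (i.e. $A$ is a bounded linear operator in $H$). Then there exist maps $F^N:H\to\mathcal{P}(H)$, $N\ge1$, each having closed, convex, bounded values, being w-upper semicontinuous and satisfying $\sup_{a\in F^N(y)}\|a\|\le C_1^N+C_2^N\|y\|$ for all $y\in H$ (for some constants $C_1^N,C_2^N>0$), with $$\mathrm{dist}_H(F^N(y),F(y))\to0\ \text{ as } N\to\infty,\quad\text{for all } y\in H,$$ such that for every $y_0\in B$ and $N\ge1$ there is a mild solution $y_N(\cdot)$ on $[0,+\infty)$ of the problem $$\frac{dy}{dt}+Ay\in F^N(y),\qquad y(0)=y_0,$$ for which $B\subset\omega(y_N)$.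
   Context: $V\subset H\subset V'$ is a Gelfand triple (of real spaces, $H$ a Hilbert space) with compact dense embeddings; $\|\cdot\|$ and $(\cdot,\cdot)$ are the norm and scalar product of $H$, $\langle\cdot,\cdot\rangle$ the pairing between $V$ and $V'$. $A:V\to V'$ is linear, continuous, self-adjoint, with $\lambda_1\|u\|_V^2\le\langle Au,u\rangle\le\lambda_2\|u\|_V^2$ for all $u\in V$, where $0<\lambda_1<\lambda_2$. $\mathcal{P}(H)$ is the set of non-empty subsets of $H$; $\mathrm{dist}(P,Q)=\sup_{a\in P}\inf_{b\in Q}\|a-b\|$, $\mathrm{dist}_H(P,Q)=\max\{\mathrm{dist}(P,Q),\mathrm{dist}(Q,P)\}$. A map $\Phi:H\to\mathcal{P}(H)$ is w-upper semicontinuous if for every $y_0\in H$ and $\varepsilon>0$ there is $\delta>0$ such that $\|y-y_0\|<\delta$ implies $\Phi(y)\subset\{z\in H:\mathrm{dist}(z,\Phi(y_0))<\varepsilon\}$. $F:H\to\mathcal{P}(H)$ has closed, convex, bounded values, is w-upper semicontinuous, and satisfies $\sup_{a\in F(y)}\|a\|\le C_1+C_2\|y\|$ for all $y\in H$, for some constants $C_1,C_2>0$. A mild solution of $\frac{dy}{dt}+Ay\in \Phi(y)$, $y(0)=y_0\in H$, is a function $y=y(t)$, $t\ge0$, such that for every $T>0$: $y\in L^2(0,T;V)$, $\frac{dy}{dt}\in L^2(0,T;V')$, and there is $f\in L^2(0,T;H)$ with $\frac{dy}{dt}+Ay=f(t)$, $f(t)\in \Phi(y(t))$ for a.a. $t\in(0,T)$,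 and $y(0)=y_0$. $\mathcal{K}\subset C([0,+\infty);H)$ is the collection of all mild solutions for $\Phi=F$, and $G(t,x)=\{\varphi(t):\varphi\in\mathcal{K},\varphi(0)=x\}$, which is a strict m-semiflow: $G(0,x)=\{x\}$, $G(t+s,x)=G(t,G(s,x))$. For $y\in C([0,\infty);H)$, $\omega(y)=\{z\in H:\exists\,t_n\to+\infty\text{ with }y(t_n)\to z\}$. A map $\phi:\mathbb{R}\to H$ is a complete trajectory of $\mathcal{K}$ if $\phi(\cdot+h)|_{[0,\infty)}\in\mathcal{K}$ for all $h\in\mathbb{R}$. A set $B\subset H$ is quasi-invariant (with respect to $G$) if for each $x\in B$ there is a complete trajectory $\phi$ of $\mathcal{K}$ with $\phi(0)=x$ and $\phi(\mathbb{R})\subset B$. Chain recurrence: for a quasi-invariant $B\subset H$, $y,z\in B$, $\varepsilon>0$, $t>0$, an $(\varepsilon,t)$-chain from $y$ to $z$ consists of finite sequences $\{y=y_1,\dots,y_{n+1}=z\}\subset B$, $\{t_1,\dots,t_n\}\subset[t,+\infty)$ with $\mathrm{dist}(y_{i+1},G(t_i,y_i))<\varepsilon$ for $i=1,\dots,n$. $B$ is chain recurrent with respect to $G$ if for every $y\in B$, $\varepsilon>0$, $t>0$ there is an $(\varepsilon,t)$-chain from $y$ to $y$. *)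

(* Defs.v *)
(* Functions of time t >= 0 are represented by functions
   R -> X whose values at t < 0 play no role. *)
From HB Require Import structures.
From mathcomp Require Import all_boot all_order all_algebra.
From mathcomp Require Import all_classical all_reals all_analysis.

Set Implicit Arguments.
Unset Strict Implicit.
Unset Printing Implicit Defensive.

Import Order.TTheory GRing.Theory Num.Theory.
Import numFieldNormedType.Exports.

Local Open Scope classical_set_scope.
Local Open Scope ring_scope.

Definition scalar_product (R : realType) (H : normedModType R)
    (ip : H -> H -> R) : Prop :=
  [/\ forall x y, ip x y = ip y x,
      forall a x y z, ip (a *: x + y) z = a * ip x z + ip y z
    & forall x, `|x| ^+ 2 = ip x x].

(* [V'] with [pair] is, up to isometry, the topological dual of [V]; the second
   condition says that the norm of [V'] is the dual norm, which also makes
   every [pair f] continuous and [f |-> pair f] injective. *)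
Definition dual_pairing (R : realType) (V V' : normedModType R)
    (pair : V' -> V -> R) : Prop :=
  [/\ (forall a f g v, pair (a *: f + g) v = a * pair f v + pair g v) /\
      (forall f a u v, pair f (a *: u + v) = a * pair f u + pair f v),
      forall f, `|f|%:E = ereal_sup [set `|pair f v|%:E | v in [set v | `|v| <= 1]]
    & forall l : {linear V -> R^o}, continuous l ->
        exists f, forall v, pair f v = l v].

Definition compact_dense_embedding (R : realType) (X Y : normedModType R)
    (f : {linear X -> Y}) : Prop :=
  [/\ injective f, continuous f, dense (range f)
    & forall B : set X, bounded_set B -> precompact (f @` B)].

(* [j] embeds V into H, and [i] embeds H into V' after identifying H with its
   own dual through the scalar product. *)
Definition gelfand_triple (R : realType) (V H V' : completeNormedModType R)
    (ip : H -> H -> R) (pair : V' -> V -> R)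
    (j : {linear V -> H}) (i : {linear H -> V'}) : Prop :=
  [/\ scalar_product ip, dual_pairing pair,
      compact_dense_embedding j, compact_dense_embedding i
    & forall h v, pair (i h) v = ip h (j v)].

(* A extends to a bounded linear operator of H. *)
Definition bounded_in_H (R : realType) (V H V' : normedModType R)
    (j : V -> H) (i : H -> V') (A : V -> V') : Prop :=
  exists2 Ah : {linear H -> H}, continuous Ah & forall u, i (Ah (j u)) = A u.

Definition simple_function (R : realType) (X : normedModType R) (s : R -> X) : Prop :=
  finite_set (range s) /\
  forall x, measurable (s @^-1` [set x] : set (measurableTypeR R)).

(* Bochner measurability; every a.e. class of Bochner measurable functions has
   a representative that is everywhere the limit of simple functions. *)
Definition strongly_measurable (R : realType) (X : normedModType R)
    (D : set R) (f : R -> X) : Prop :=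
  exists2 s : nat -> R -> X, (forall n, simple_function (s n)) &
    forall t, D t -> s n t @[n --> \oo] --> f t.

Definition L2 (R : realType) (X : normedModType R) (T : R) (f : R -> X) : Prop :=
  strongly_measurable `]0, T[ f /\
  (\int[@lebesgue_measure R]_(t in `]0%R, T[) (`|f t| ^+ 2)%R%:E < +oo)%E.

Definition test_function (R : realType) (T : R) (psi : R -> R) : Prop :=
  [/\ forall t, derivable psi t 1, continuous (derive1 psi)
    & exists a b, [/\ 0 < a, a < b, b < T
                   & forall t, ~ (a <= t <= b) -> psi t = 0]].

(* du/dt = g in the sense of V'-valued distributions on (0,T): the identity
   \int u psi' = - \int g psi in V', evaluated at the elements of V. *)
Definition weak_derivative (R : realType) (V V' : normedModType R)
    (pair : V' -> V -> R) (T : R) (u g : R -> V') : Prop :=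
  forall psi, test_function T psi -> forall v : V,
    \int[@lebesgue_measure R]_(t in `]0, T[) (pair (u t) v * derive1 psi t) =
    - \int[@lebesgue_measure R]_(t in `]0, T[) (pair (g t) v * psi t).

(* A y with y in L^2(0,T;V) and dy/dt in L^2(0,T;V') is a.e. equal to a unique
   continuous H-valued function; y is that representative, so that [y 0] makes
   sense. *)
Definition mild_solution (R : realType) (V H V' : normedModType R)
    (pair : V' -> V -> R) (j : V -> H) (i : H -> V') (A : V -> V')
    (Phi : H -> set H) (y0 : H) (y : R -> H) : Prop :=
  [/\ {within `[0, +oo[, continuous y},
      forall T : R, 0 < T ->
        exists v : R -> V, exists dy : R -> V', exists f : R -> H,
          [/\ L2 T v /\
              {ae @lebesgue_measure R, forall t, 0 < t < T -> y t = j (v t)},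
              L2 T dy /\ weak_derivative pair T (i \o y) dy,
              L2 T f,
              {ae @lebesgue_measure R, forall t, 0 < t < T ->
                 dy t + A (v t) = i (f t)}
            & {ae @lebesgue_measure R, forall t, 0 < t < T -> Phi (y t) (f t)}]
    & y 0 = y0].

Definition mild_solutions (R : realType) (V H V' : normedModType R)
    (pair : V' -> V -> R) (j : V -> H) (i : H -> V') (A : V -> V')
    (Phi : H -> set H) : set (R -> H) :=
  [set y | exists y0, mild_solution pair j i A Phi y0 y].

Section SetDistances.
Context {R : realType} {H : normedModType R}.
Implicit Types P Q : set H.

Definition dist P Q : \bar R :=
  ereal_sup [set ereal_inf [set `|a - b|%:E | b in Q] | a in P].

Definition distH P Q : \bar R := maxe (dist P Q) (dist Q P).

Definition ccb_values (Phi : H -> set H) : Prop :=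
  forall y, [/\ Phi y !=set0, closed (Phi y),
                convex_set (Phi y : set (convex_lmodType H))
              & bounded_set (Phi y)].

Definition w_usc (Phi : H -> set H) : Prop :=
  forall y0 (eps : R), 0 < eps -> exists2 delta : R, 0 < delta &
    forall y, `|y - y0| < delta ->
      Phi y `<=` [set z | (dist [set z] (Phi y0) < eps%:E)%E].

Definition linear_growth (Phi : H -> set H) : Prop :=
  exists C1 C2 : R, [/\ 0 < C1, 0 < C2 &
    forall y, (ereal_sup [set `|a|%:E | a in Phi y] <= (C1 + C2 * `|y|)%:E)%E].

End SetDistances.

Section Dynamics.
Context {R : realType} {H : normedModType R}.

Definition omega_limit (y : R -> H) : set H :=
  [set z | exists2 t : nat -> R, t @ \oo --> +oo & y (t n) @[n --> \oo] --> z].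

Definition semiflow (K : set (R -> H)) (t : R) (x : H) : set H :=
  [set phi t | phi in [set phi | K phi /\ phi 0 = x]].

Definition complete_trajectory (K : set (R -> H)) (phi : R -> H) : Prop :=
  forall h : R, K (fun t => phi (t + h)).

Definition quasi_invariant (K : set (R -> H)) (B : set H) : Prop :=
  forall x, B x -> exists phi, [/\ complete_trajectory K phi, phi 0 = x
                                 & range phi `<=` B].

Definition chain (G : R -> H -> set H) (B : set H) (eps t : R) (y z : H) : Prop :=
  exists (n : nat) (y_ : nat -> H) (t_ : nat -> R),
    [/\ (0 < n)%N, y_ 0%N = y /\ y_ n = z,
        forall k, (k <= n)%N -> B (y_ k)
      & forall k, (k < n)%N ->
          t <= t_ k /\ (dist [set y_ k.+1] (G (t_ k) (y_ k)) < eps%:E)%E].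

Definition chain_recurrent (G : R -> H -> set H) (B : set H) : Prop :=
  forall y, B y -> forall eps t : R, 0 < eps -> 0 < t -> chain G B eps t y y.

End Dynamics.

(* Main.v *)
Require Import Defs.
From HB Require Import structures.
From mathcomp Require Import all_boot all_order all_algebra.
From mathcomp Require Import all_classical all_reals all_analysis.
From mathcomp Require Import measurable_realfun.
From mathcomp Require Import ring lra.

Set Implicit Arguments.
Unset Strict Implicit.
Unset Printing Implicit Defensive.

Import Order.TTheory GRing.Theory Num.Theory.
Import numFieldNormedType.Exports.

Local Open Scope classical_set_scope.
Local Open Scope ring_scope.

(* Since A is coercive on V and bounded on H, the norms of V and H are equivalent:
   j is onto, and a mild solution is a curve in H solving y' + Ah y = f weakly.
   Take for F^N(y) the closed neighbourhood of F_N(y) of radius 1/(N+1).  A jump of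
   size < eps at the end of a solution for F is repaired by adding to the solution
   a correction linear in time; as F_N is Lipschitz, the result solves the inclusion
   for F^N when eps is small.  Chain recurrence and connectedness of B then join any
   two points of B by solutions for F^N, and concatenating such solutions along a
   sequence that clusters at every point of B gives y_N.  Concatenation preserves
   the weak equation: multiply the test function by a C^1 cutoff that vanishes near
   the junction and let the cutoff tend to 1. *)

(** * C^1 cutoffs *)

(** The neighbourhood of radius 1/(N+1) is what pays for the corrections: [F] itself leaves no slack
    in the inclusion and, being only w-upper semicontinuous, gives no quantitative control when its
    argument moves. The Lipschitz constant of [F_N] is valid on all of H, so the jump size that can
    be repaired depends on N alone and not on the solution or its duration, provided that every
    duration is at least 1, since a correction [e] adds [e / tau] to the derivative.

    Chain recurrence only leads from a point back to itself. Moving the end of such a chain to a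
    nearby point is one more small jump, so every point of B reaches all its neighbours within a
    uniform distance; this uniformity is what connectedness needs. The joining solutions may leave B
    in between; the omega-limit set is controlled through the junction points alone.

    All equations are tested against a fixed vector, so that translation, gluing and correction are
    statements about real integrals. Nothing is lost, because [j] is onto and every vector of H is
    [j v] for some v in V. *)

Definition c1_fun (R : realType) (f : R -> R) : Prop :=
  (forall t, derivable f t 1) /\ continuous (derive1 f).

Section Cutoff.
Context {R : realType}.
Implicit Types (f g psi : R -> R) (c x : R).

(** A quadratic remainder treats the kink of [pos_part] at 0 and the smooth points alike: for
    [pos_part y ^+ 2] the bound is a piecewise polynomial inequality. *)
Lemma is_derive_quadratic f (x d K : R) :
  (forall h, `|f (x + h) - f x - d * h| <= K * h ^+ 2) -> is_derive x 1 f d.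
Proof.
move=> fK.
have fd : h^-1 *: (f (h *: 1 + x) - f x) @[h --> 0^'] --> d.
  apply/cvgrPdist_le => /= e e0.
  have K0 : 0 <= K.
    by have := le_trans (normr_ge0 _) (fK 1); rewrite expr1n mulr1.
  near=> h.
  have h0 : h != 0 by near: h; exact: nbhs_dnbhs_neq.
  rewrite -normrN opprB /GRing.scale/= mulr1 [h + x]addrC.
  have -> : h^-1 * (f (x + h) - f x) - d = h^-1 * (f (x + h) - f x - d * h).
    by field.
  rewrite normrM normfV ler_pdivrMl ?normr_gt0//.
  apply: le_trans (fK h) _.
  rewrite -normr_id -[h ^+ 2]ger0_norm ?sqr_ge0// normrX normr_id expr2.
  rewrite mulrCA ler_wpM2l//.
  have : `|h| <= e / (K + 1).
    near: h; apply: dnbhs0_le; rewrite divr_gt0//; lra.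
  rewrite ler_pdivlMr; last lra.
  by apply: le_trans; rewrite mulrDr mulr1 mulrC lerDl.
apply: DeriveDef; last exact/cvg_lim.
by apply/cvg_ex; exists d.
Unshelve. all: by end_near. Qed.

Definition pos_part (x : R) : R := Num.max 0 x.

Lemma is_derive_sqr_pos_part (x : R) :
  is_derive x 1 (fun y => pos_part y ^+ 2) (2 * pos_part x).
Proof.
apply: (@is_derive_quadratic _ _ _ 1) => h.
rewrite mul1r /pos_part ler_norml.
case: (leP 0 (x + h)); case: (leP 0 x) => ? ?; apply/andP; split; nra.
Qed.

Lemma continuous_pos_part : continuous pos_part.
Proof. by move=> x; apply: continuous_max; [exact: cvg_cst|exact: cvg_id]. Qed.

(* The quadratic B-spline step: its derivative is the hat function on [0, 1]. *)
Definition step (x : R) : R :=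
  2 * (pos_part x ^+ 2 - 2 * pos_part (x - 2^-1) ^+ 2 + pos_part (x - 1) ^+ 2).

Definition hat (x : R) : R :=
  4 * (pos_part x - 2 * pos_part (x - 2^-1) + pos_part (x - 1)).

Lemma step_le0 x : x <= 0 -> step x = 0.
Proof.
move=> x0; rewrite /step /pos_part !max_l ?expr0n/=; [ring|lra|lra|lra].
Qed.

Lemma step_ge1 x : 1 <= x -> step x = 1.
Proof.
move=> x0; rewrite /step /pos_part.
case: (leP 0 x); case: (leP 0 (x - 2^-1)); case: (leP 0 (x - 1)) => ? ? ?;
  first [by field | lra].
Qed.

Lemma step_itv x : 0 <= step x <= 1.
Proof.
rewrite /step /pos_part.
case: (leP 0 x); case: (leP 0 (x - 2^-1)); case: (leP 0 (x - 1)) => ? ? ?;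
  apply/andP; split; nra.
Qed.

Lemma hat_out x : x <= 0 \/ 1 <= x -> hat x = 0.
Proof.
move=> x0; rewrite /hat /pos_part.
case: (leP 0 x); case: (leP 0 (x - 2^-1)); case: (leP 0 (x - 1)) => ? ? ?; lra.
Qed.

Lemma hat_itv x : 0 <= hat x <= 2.
Proof.
rewrite /hat /pos_part.
case: (leP 0 x); case: (leP 0 (x - 2^-1)); case: (leP 0 (x - 1)) => ? ? ?;
  apply/andP; split; lra.
Qed.

Lemma is_derive_step x : is_derive x 1 step (hat x).
Proof.
have is_derive_shift c : is_derive x 1 (fun y => pos_part (y - c) ^+ 2)
    (2 * pos_part (x - c)).
  have := @is_derive1_comp _ (fun y => pos_part y ^+ 2) (fun y => y - c) x
    (2 * pos_part (x - c)) 1 (is_derive_sqr_pos_part _).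
  rewrite mulr1; apply.
  by apply: is_derive_eq; rewrite subr0.
rewrite /step.
have H0 := is_derive_sqr_pos_part x.
have H1 := is_derive_shift 2^-1; have H2 := is_derive_shift 1.
apply: (is_derive_eq
  (is_deriveZ 2 (is_deriveD (is_deriveB H0 (is_deriveZ 2 H1)) H2))).
by rewrite /hat/GRing.scale/=; ring.
Qed.

Lemma continuous_hat : continuous hat.
Proof.
have cp c : continuous (fun x => pos_part (x - c)).
  move=> x; apply: (@continuous_comp _ _ _ (fun x => x - c) pos_part).
    by apply: cvgB; [exact: cvg_id|exact: cvg_cst].
  exact: continuous_pos_part.
move=> x; apply: cvgM; first exact: cvg_cst.
apply: cvgD; last exact: cp.
apply: cvgB; first exact: continuous_pos_part.
by apply: cvgM; [exact: cvg_cst|exact: cp].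
Qed.

Lemma c1_fun_is_derive f (df : R -> R) :
  (forall t, is_derive t (1 : R) f (df t)) -> continuous df ->
  c1_fun f /\ derive1 f = df.
Proof.
move=> fdf cdf.
have E : derive1 f = df.
  by apply/funext => t; rewrite derive1E; have [_ ->] := fdf t.
by split=> //; split; [move=> t; have [] := fdf t|rewrite E].
Qed.

Lemma c1_fun_continuous f : c1_fun f -> continuous f.
Proof. by move=> [df _] x; apply/differentiable_continuous/derivable1_diffP. Qed.

Lemma c1_funM f g : c1_fun f -> c1_fun g ->
  c1_fun (f \* g) /\ derive1 (f \* g) = (fun t => f t * derive1 g t + derive1 f t * g t).
Proof.
move=> cf cg; apply: c1_fun_is_derive => [t|].
  have [[/(_ t) df _] [/(_ t) dg _]] := (cf, cg).
  have /derivableP df' := df; have /derivableP dg' := dg.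
  apply: (is_derive_eq (is_deriveM df' dg')); rewrite -!derive1E.
  by rewrite /GRing.scale/=; ring.
move=> t; apply: cvgD; apply: cvgM.
- exact: c1_fun_continuous.
- by have [_] := cg; apply.
- by have [_] := cf; apply.
- exact: c1_fun_continuous.
Qed.

Lemma c1_funD f g : c1_fun f -> c1_fun g ->
  c1_fun (f \+ g) /\ derive1 (f \+ g) = (fun t => derive1 f t + derive1 g t).
Proof.
move=> [df cf] [dg cg]; apply: c1_fun_is_derive => [t|].
  have /derivableP df' := df t; have /derivableP dg' := dg t.
  by rewrite !derive1E; exact: is_deriveD df' dg'.
by move=> t; apply: cvgD; [exact: cf|exact: cg].
Qed.

Lemma c1_fun_affine f (k c : R) : c1_fun f ->
  c1_fun (fun t => f (k * t + c)) /\
  derive1 (fun t => f (k * t + c)) = (fun t => k * derive1 f (k * t + c)).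
Proof.
move=> [df cdf]; apply: c1_fun_is_derive => [t|].
  have /derivableP df' := df (k * t + c).
  have := @is_derive1_comp _ f (fun y => k * y + c) t _ k df'.
  rewrite -derive1E mulrC; apply.
  by apply: is_derive_eq; rewrite /GRing.scale/= addr0 mulr1.
move=> t; apply: cvgM; first exact: cvg_cst.
apply: (@continuous_comp _ _ _ (fun t => k * t + c) (derive1 f)); last exact: cdf.
by apply: cvgD; [apply: cvgM; [exact: cvg_cst|exact: cvg_id]|exact: cvg_cst].
Qed.

Lemma c1_fun_step : c1_fun step /\ derive1 step = hat.
Proof. exact: c1_fun_is_derive is_derive_step continuous_hat. Qed.

End Cutoff.

(** * Weak derivatives on intervals *)

Section WeakDerivative.
Context {R : realType}.
Implicit Types (a b c s : R) (u g h psi k : R -> R).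
Notation mu := (@lebesgue_measure R).

Definition integrable_oo a b h := mu.-integrable `]a, b[ (EFin \o h).

(** The order [a' <= b'] is not imposed: the product of a test function with a one-sided cutoff may
    vanish identically, and its two bounds may then be reversed. *)
Definition compact_support a b psi :=
  exists a' b', [/\ a < a', b' < b & forall t, ~ (a' <= t <= b') -> psi t = 0].

Definition weak_deriv a b u g := forall psi, c1_fun psi ->
  compact_support a b psi ->
  \int[mu]_(t in `]a, b[) (u t * derive1 psi t) =
  - \int[mu]_(t in `]a, b[) (g t * psi t).

Lemma derive1_out psi (a b : R) : (forall t, ~ (a <= t <= b) -> psi t = 0) ->
  forall t, ~ (a <= t <= b) -> derive1 psi t = 0.
Proof.
move=> psi0 t tab; rewrite derive1E.
have -> : 'D_1 psi t = 'D_1 (cst 0 : R -> R) t; last exact: derive_val.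
apply: near_eq_derive.
have opn : open (~` [set` `[a, b]]) by apply: closed_openC; exact: interval_closed.
have nt : (~` [set` `[a, b]]) t by rewrite /= in_itv.
have /open_nbhs_nbhs := conj opn nt.
by apply: filterS => x /=; rewrite in_itv /= => /psi0.
Qed.

Lemma Rintegral_support (D E : set R) h : D `<=` E ->
  (forall t, E t -> ~ D t -> h t = 0) ->
  \int[mu]_(t in D) h t = \int[mu]_(t in E) h t.
Proof.
move=> DE h0; rewrite Rintegral_mkcond [RHS]Rintegral_mkcond.
apply: eq_Rintegral => t _; rewrite !patchE.
case: ifPn => [|tD]; first by rewrite inE => /DE tE; rewrite mem_set.
case: ifPn => // /[!inE] tE; apply/esym/h0 => // Dt; move: tD.
by rewrite mem_set.
Qed.

Lemma integrable_ooM a b h k : integrable_oo a b h -> continuous k ->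
  integrable_oo a b (h \* k).
Proof.
move=> ih ck.
rewrite /integrable_oo.
have -> : EFin \o (h \* k) = ((EFin \o h) \* (EFin \o k))%E by [].
apply: integrableMl => //; first exact: measurable_funTS (continuous_measurable_fun ck).
have /compact_bounded[M [Mr kM]] : compact (k @` `[a, b]).
  apply: continuous_compact; last exact: segment_compact.
  exact: continuous_subspaceT.
exists M; split => // x Mx y /= yab; apply: kM => //.
by exists y => //; exact: subset_itv_oo_cc.
Qed.

Lemma continuous_integrable_oo a b u : {within `[a, b], continuous u} ->
  integrable_oo a b u.
Proof.
move=> cu; have : mu.-integrable `[a, b] (EFin \o u).
  by apply: continuous_compact_integrable => //; exact: segment_compact.
by apply: integrableS => //; exact: subset_itv_oo_cc.
Qed.

Lemma subset_oo a b a' b' : a <= a' -> b' <= b ->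
  [set` `]a', b'[] `<=` [set` `]a, b[].
Proof.
move=> aa bb t; rewrite /= !in_itv /= => /andP[at' tb].
by rewrite (le_lt_trans aa at') (lt_le_trans tb bb).
Qed.

Lemma integrable_oo_sub a b a' b' h : a <= a' -> b' <= b ->
  integrable_oo a b h -> integrable_oo a' b' h.
Proof.
by move=> aa bb; apply: integrableS => //; exact: subset_oo.
Qed.

Lemma weak_deriv_eq a b u g u' g' :
  (forall t, a < t < b -> u t = u' t) -> (forall t, a < t < b -> g t = g' t) ->
  weak_deriv a b u g -> weak_deriv a b u' g'.
Proof.
move=> uu' gg' w psi cpsi spsi; have := w psi cpsi spsi.
have -> : \int[mu]_(t in `]a, b[) (u t * derive1 psi t) =
          \int[mu]_(t in `]a, b[) (u' t * derive1 psi t).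
  by apply: eq_Rintegral => t; rewrite inE /= in_itv /= => /uu' ->.
move=> ->; congr (- _).
by apply: eq_Rintegral => t; rewrite inE /= in_itv /= => /gg' ->.
Qed.

Lemma compact_support_sub a b a' b' psi : a <= a' -> b' <= b ->
  compact_support a' b' psi -> compact_support a b psi.
Proof.
move=> aa bb [x [y [ax yb xy]]]; exists x, y; split => //.
  exact: le_lt_trans ax.
exact: lt_le_trans bb.
Qed.

Lemma weak_deriv_sub_psi a b a' b' u g psi :
  a <= a' -> b' <= b -> compact_support a' b' psi ->
  \int[mu]_(t in `]a', b'[) (u t * derive1 psi t) =
    \int[mu]_(t in `]a, b[) (u t * derive1 psi t) /\
  \int[mu]_(t in `]a', b'[) (g t * psi t) = \int[mu]_(t in `]a, b[) (g t * psi t).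
Proof.
move=> aa bb [x [y [ax yb xy]]].
have sub : [set` `]a', b'[] `<=` [set` `]a, b[].
  exact: subset_oo.
have out t : ~ [set` `]a', b'[] t -> ~ (x <= t <= y).
  rewrite /= in_itv /= => nt /andP[xt ty]; apply: nt.
  by rewrite (lt_le_trans ax xt) (le_lt_trans ty yb).
split; apply: Rintegral_support => // t _ /out tn.
  by rewrite (derive1_out xy)// mulr0.
by rewrite xy// mulr0.
Qed.

Lemma weak_deriv_sub a b a' b' u g : a <= a' -> b' <= b ->
  weak_deriv a b u g -> weak_deriv a' b' u g.
Proof.
move=> aa bb w psi cpsi spsi.
have [-> ->] := weak_deriv_sub_psi u g aa bb spsi.
exact/w/(compact_support_sub aa bb).
Qed.

Lemma Rintegral_derive1 a b k : a < b -> c1_fun k ->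
  \int[mu]_(t in `]a, b[) derive1 k t = k b - k a.
Proof.
move=> ab ck; have ck1 := c1_fun_continuous ck; have [dk cdk] := ck.
have ik : mu.-integrable `[a, b] (EFin \o derive1 k).
  apply: continuous_compact_integrable; first exact: segment_compact.
  exact: continuous_subspaceT.
rewrite Rintegral_itv_bndo_bndc; last first.
  by apply: integrableS ik => //; exact: subset_itv_oo_cc.
rewrite Rintegral_itv_obnd_cbnd; last first.
  by apply: integrableS ik => //; exact: subset_itv_oc_cc.
have -> : k b - k a = fine ((k b)%:E - (k a)%:E)%E by [].
congr fine; apply: continuous_FTC2 ab _ _ _; last by [].
  exact: continuous_subspaceT.
split.
- by move=> x _; exact: dk.
- exact/cvg_at_right_filter/ck1.
- exact/cvg_at_left_filter/ck1.
Qed.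

Lemma weak_derivD a b u g u' g' :
  {within `[a, b], continuous u} -> {within `[a, b], continuous u'} ->
  integrable_oo a b g -> integrable_oo a b g' ->
  weak_deriv a b u g -> weak_deriv a b u' g' ->
  weak_deriv a b (u \+ u') (g \+ g').
Proof.
move=> cu cu' ig ig' w w' psi cpsi spsi.
have cpsi1 := c1_fun_continuous cpsi; have [_ cdpsi] := cpsi.
under eq_Rintegral do rewrite /= mulrDl.
under [in RHS]eq_Rintegral do rewrite /= mulrDl.
have iu := continuous_integrable_oo cu; have iu' := continuous_integrable_oo cu'.
rewrite RintegralD//; [|exact: integrable_ooM..].
rewrite RintegralD//; [|exact: integrable_ooM..].
by rewrite w// w'// opprD.
Qed.

(** Integration by parts: the derivative of [(x * t + y) * psi t] has integral zero, because [psi]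
    vanishes at both ends. *)
Lemma weak_deriv_affine a b (x y : R) :
  weak_deriv a b (fun t => x * t + y) (fun=> x).
Proof.
move=> psi cpsi spsi.
have [ba|ab] := leP b a.
  by rewrite set_itv_ge ?bnd_simp -?leNgt// !Rintegral_set0 oppr0.
have cpsi1 := c1_fun_continuous cpsi; have [_ cdpsi] := cpsi.
have [cl dl] : c1_fun (fun t => x * t + y) /\
    derive1 (fun t => x * t + y) = fun=> x.
  apply: c1_fun_is_derive; last exact: cst_continuous.
  by move=> t; apply: is_derive_eq; rewrite /GRing.scale/= addr0 mulr1.
have [cm dm] := c1_funM cl cpsi.
have := Rintegral_derive1 ab cm; rewrite dm dl /=.
have [a' [b' [aa' bb' psi0]]] := spsi.
have -> : psi a = 0 by apply: psi0; rewrite leNgt aa'.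
have -> : psi b = 0 by apply: psi0; rewrite [b <= _]leNgt bb' andbF.
rewrite !mulr0 subr0 RintegralD//.
- by move/eqP; rewrite addr_eq0 => /eqP.
- apply: (@integrable_ooM _ _ (fun t => x * t + y)) => //.
  by apply: continuous_integrable_oo; exact/continuous_subspaceT/c1_fun_continuous.
- apply: (@integrable_ooM _ _ (fun=> x)) => //.
  apply: continuous_integrable_oo; apply/continuous_subspaceT; exact: cst_continuous.
Qed.

(** Equal to 0 for |t - c| <= 1/(n+1) and to 1 for |t - c| >= 2/(n+1). It is a sum of two one-sided
    steps, so that its product with a test function splits into one test function on each side of
    [c]. *)
Definition cutoff c (n : nat) (t : R) : R :=
  step (n.+1%:R * t - (n.+1%:R * c + 1)) + step (- n.+1%:R * t + (n.+1%:R * c - 1)).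

Lemma cutoff_cvg c t : t != c -> cutoff c n t @[n --> \oo] --> (1 : R).
Proof.
move=> tc; apply: cvg_near_cst.
near=> n.
have H : 2 <= n.+1%:R * `|t - c|.
  rewrite -ler_pdivrMr ?normr_gt0 ?subr_eq0//.
  near: n; apply: filterS (nbhs_infty_gtr (2 / `|t - c|)) => n /ltW le_n.
  by rewrite (le_trans le_n)// ler_nat.
rewrite /cutoff; have [ltc|ltc] : t < c \/ c < t by apply/orP; rewrite -neq_lt.
  rewrite step_le0 ?step_ge1 ?add0r//; move: H; rewrite ltr0_norm ?subr_lt0//; nra.
rewrite [X in _ + X]step_le0 ?step_ge1 ?addr0//; move: H;
  rewrite gtr0_norm ?subr_gt0//; nra.
Unshelve. all: by end_near. Qed.

Lemma cutoff_itv c n t : 0 <= cutoff c n t <= 2.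
Proof.
rewrite /cutoff.
have /andP[] := step_itv (n.+1%:R * t - (n.+1%:R * c + 1)).
have /andP[] := step_itv (- n.+1%:R * t + (n.+1%:R * c - 1)).
by move=> *; apply/andP; split; lra.
Qed.

Lemma c1_fun_cutoff c n : c1_fun (cutoff c n) /\ derive1 (cutoff c n) =
  (fun t => n.+1%:R * hat (n.+1%:R * t - (n.+1%:R * c + 1)) +
            - n.+1%:R * hat (- n.+1%:R * t + (n.+1%:R * c - 1))).
Proof.
have [cs ds] := @c1_fun_step R.
have [c1 d1] := c1_fun_affine n.+1%:R (- (n.+1%:R * c + 1)) cs.
have [c2 d2] := c1_fun_affine (- n.+1%:R) (n.+1%:R * c - 1) cs.
have := c1_funD c1 c2.
by rewrite d1 d2 ds.
Qed.

(** Dominated convergence with bound 2 |h|; the cutoffs tend to 1 except at [t = c], a null set. *)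
Lemma Rintegral_cutoff a b c h : integrable_oo a b h ->
  \int[mu]_(t in `]a, b[) (h t * cutoff c n t) @[n --> \oo] -->
  \int[mu]_(t in `]a, b[) h t.
Proof.
move=> ih.
have mh : measurable_fun `]a, b[ h by apply/measurable_EFinP; case/integrableP: ih.
have mk n : measurable_fun `]a, b[ (cutoff c n).
  have [/c1_fun_continuous ckn _] := c1_fun_cutoff c n.
  exact: measurable_funTS (continuous_measurable_fun ckn).
have [] := @dominated_convergence _ _ _ mu `]a, b[ (measurable_itv _)
  (fun n t => (h t * cutoff c n t)%:E) (EFin \o h) (fun t => 2%:E * `|(h t)%:E|)%E.
- by move=> n; apply/measurable_EFinP/measurable_funM => //; exact: mk.
- exact/measurable_EFinP.
- exists [set c]; split; [exact: measurable_set1|exact: lebesgue_measure_set1|].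
  move=> t /= tn; apply: contrapT => /eqP tc; apply: tn => tab.
  apply: cvg_EFin; first by near=> n.
  rewrite -[X in _ --> X]mulr1.
  by apply: cvgM; [exact: cvg_cst|exact: cutoff_cvg].
- by apply: integrableZl => //; exact: integrable_abse.
- apply: aeW => t n tab; rewrite lee_fin normrM mulrC ler_wpM2r//.
  by have /andP[k0 k2] := cutoff_itv c n t; rewrite ger0_norm.
move=> _ _ cv.
rewrite /Rintegral; apply: fine_cvg.
by rewrite fineK //; exact: integrable_fin_num.
Unshelve. all: by end_near. Qed.

(** The derivative of the cutoff is of order n on a set of length of order 1/n around [c], so the
    integral is controlled by the supremum of |h| there, which is small because h is continuous and
    [h c = 0]. *)
Lemma Rintegral_cutoff_derive a b c h : a < c -> c < b ->
  {within `[a, b], continuous h} -> h c = 0 ->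
  \int[mu]_(t in `]a, b[) (h t * derive1 (cutoff c n) t) @[n --> \oo] --> (0 : R).
Proof.
move=> ac cb ch hc0.
have ih := continuous_integrable_oo ch.
have hc : h t @[t --> c] --> h c.
  have ab := lt_trans ac cb.
  have [ci _ _] := (continuous_within_itvP h ab).1 ch.
  by apply: ci; rewrite in_itv /= ac.
apply/cvgr0Pnorm_le => e e0.
(* The 16 is the bound [4 * N] on the derivative of the cutoff times the length [4 / N] of the
   interval [D] that carries it. *)
have e8 : 0 < e / 16 by rewrite divr_gt0.
have [d /= d0 hd] : \forall t \near c, `|h t| <= e / 16.
  by move/cvgrPdist_le : hc => /(_ _ e8); apply: filterS => t; rewrite hc0 sub0r normrN.
have H (x : R) : 0 < x -> \forall n \near \oo, 2 < n.+1%:R * x.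
  move=> x0; apply: filterS (nbhs_infty_gtr (2 / x)) => m gt_m.
  by rewrite -ltr_pdivrMr// (lt_le_trans gt_m)// ler_nat.
near=> n.
have Nd : 2 < n.+1%:R * d by near: n; exact: H.
have Na : 2 < n.+1%:R * (c - a) by near: n; apply: H; rewrite subr_gt0.
have Nb : 2 < n.+1%:R * (b - c) by near: n; apply: H; rewrite subr_gt0.
set N : R := n.+1%:R in Nd Na Nb.
have N0 : 0 < N by rewrite ltr0n.
have [ck dk] := c1_fun_cutoff c n; rewrite -/N in dk.
(* The half-width of [D] is kept as a variable with [N * M = 2], which spares the arithmetic tactics
   a quotient. *)
have [M ME] : exists M, M = 2 / N by exists (2 / N).
have M0 : 0 < M by rewrite ME divr_gt0.
have MN : N * M = 2 by rewrite ME; field; rewrite gt_eqF.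
have Md : M < d by rewrite ME ltr_pdivrMr// mulrC.
have Ma : M < c - a by rewrite ME ltr_pdivrMr// mulrC.
have Mb : M < b - c by rewrite ME ltr_pdivrMr// mulrC.
pose D := [set` `[c - M, c + M]].
have Dab : D `<=` [set` `]a, b[].
  move=> t; rewrite /D /= !in_itv /= => /andP[t1 t2].
  by apply/andP; split; [apply: lt_le_trans t1|apply: le_lt_trans t2 _]; lra.
rewrite -(@Rintegral_support D)//; last first.
  move=> t _; rewrite /D /= in_itv /= => /negP; rewrite negb_and -!ltNge => tD.
  have tN : 2 < N * (c - t) \/ 2 < N * (t - c).
    by case/orP: tD => tD; [left|right]; rewrite -MN ltr_pM2l//; lra.
  by rewrite dk !hat_out ?mulr0 ?addr0 ?mulr0//;
    case: tN => tN; [right|left|left|right]; lra.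
have ihk : mu.-integrable D (EFin \o (h \* derive1 (cutoff c n))).
  have ihab : integrable_oo a b (h \* derive1 (cutoff c n)).
    by apply: integrable_ooM => //; have [] := ck.
  by apply: integrableS ihab => //; exact: measurable_itv.
have mD : measurable (D : set (measurableTypeR R)) by exact: measurable_itv.
apply: le_trans (le_normr_Rintegral mD ihk) _.
apply: (@le_trans _ _ (\int[mu]_(t in D) (e / 16 * (4 * N)))).
  apply: le_Rintegral => //.
  - exact: integrable_norm.
  - apply: continuous_compact_integrable; first exact: segment_compact.
    apply: continuous_subspaceT; exact: cst_continuous.
  move=> t; rewrite /D /= in_itv /= => /andP[t1 t2]; rewrite normrM.
  apply: ler_pM => //.
    by apply: hd => /=; rewrite ltr_norml; apply/andP; split; lra.
  rewrite dk ler_norml.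
  have /andP[] := hat_itv (N * t - (N * c + 1)).
  have /andP[] := hat_itv (- N * t + (N * c - 1)).
  by move=> *; apply/andP; split; nra.
have -> : \int[mu]_(t in D) (e / 16 * (4 * N)) = e / 16 * (4 * N) * fine (mu D).
  exact: Rintegral_cst.
have -> : mu D = (c + M - (c - M))%:E.
  by rewrite /D lebesgue_measure_itv /= lte_fin ifT -?EFinB//; lra.
rewrite /=.
have -> : e / 16 * (4 * N) * (c + M - (c - M)) = e; last exact: lexx.
by transitivity (e / 2 * (N * M)); [field|rewrite MN; field].
Unshelve. all: by end_near. Qed.

(** The term in which the derivative falls on the cutoff tends to 0 because [u c = 0]. For another
    value at [c] it would vanish only by cancellation between the two sides, which this
    normalization avoids. *)
Lemma weak_deriv_glue0 a b c u g : a < c -> c < b ->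
  {within `[a, b], continuous u} -> integrable_oo a b g -> u c = 0 ->
  weak_deriv a c u g -> weak_deriv c b u g -> weak_deriv a b u g.
Proof.
move=> ac cb cu ig uc0 wl wr psi cpsi spsi.
have cpsi1 := c1_fun_continuous cpsi; have [_ cdpsi] := cpsi.
have iu := continuous_integrable_oo cu.
(* The sum of the two one-sided equations, for [psi] times the left step [l] on []a, c[] and [psi]
   times the right step [r] on []c, b[], with the product rule expanded. *)
have H n : \int[mu]_(t in `]a, b[) (u t * derive1 psi t * cutoff c n t) +
    \int[mu]_(t in `]a, b[) (u t * psi t * derive1 (cutoff c n) t) =
    - \int[mu]_(t in `]a, b[) (g t * psi t * cutoff c n t).
  have [cs ds] := @c1_fun_step R.
  have [cr dr] := c1_fun_affine n.+1%:R (- (n.+1%:R * c + 1)) cs.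
  have [cl dl] := c1_fun_affine (- n.+1%:R) (n.+1%:R * c - 1) cs.
  set r := (X in c1_fun X) in cr; set l := (X in c1_fun X) in cl.
  have [cpr dpr] := c1_funM cpsi cr; have [cpl dpl] := c1_funM cpsi cl.
  have [_ dk] := c1_funD cl cr.
  have N0 : 0 < n.+1%:R :> R by rewrite ltr0n.
  have n0 : n.+1%:R * n.+1%:R^-1 = 1 :> R by rewrite divff// gt_eqF.
  have V0 : 0 < n.+1%:R^-1 :> R by rewrite invr_gt0.
  have [a' [b' [aa' bb' psi0]]] := spsi.
  have spl : compact_support a c (psi \* l).
    exists a', (c - n.+1%:R^-1); split => //; first by rewrite ltrBlDr ltrDl.
    move=> t /negP; rewrite negb_and -!ltNge => /orP[ta|tc].
      by rewrite /= psi0 ?mul0r// leNgt ta.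
    rewrite /l /= step_le0 ?mulr0//.
    move: tc; rewrite -(ltr_pM2l N0) mulrBr n0; lra.
  have spr : compact_support c b (psi \* r).
    exists (c + n.+1%:R^-1), b'; split => //; first by rewrite ltrDl.
    move=> t /negP; rewrite negb_and -!ltNge => /orP[tc|tb].
      rewrite /r /= step_le0 ?mulr0//.
      move: tc; rewrite -(ltr_pM2l N0) mulrDr n0; lra.
    by rewrite /= psi0 ?mul0r// [t <= _]leNgt tb andbF.
  have := wl _ cpl spl; have := wr _ cpr spr.
  have [-> ->] := weak_deriv_sub_psi u g (lexx a) (ltW cb) spl.
  have [-> ->] := weak_deriv_sub_psi u g (ltW ac) (lexx b) spr.
  move=> Er El.
  have ck : c1_fun (cutoff c n) by have [] := c1_fun_cutoff c n.
  have ckc := c1_fun_continuous ck.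
  rewrite -RintegralD//; first last.
  - apply: (@integrable_ooM _ _ (u \* psi)); last by have [] := ck.
    exact: integrable_ooM.
  - by apply: (@integrable_ooM _ _ (u \* derive1 psi)) => //; exact: integrable_ooM.
  transitivity (\int[mu]_(t in `]a, b[) (u t * derive1 (psi \* l) t +
     u t * derive1 (psi \* r) t)).
    apply: eq_Rintegral => t _; rewrite dpl dpr.
    have -> : cutoff c n = l \+ r by apply/funext => x; rewrite /cutoff addrC.
    rewrite dk /=; ring.
  have [_ cdl] := cpl; have [_ cdr] := cpr.
  rewrite RintegralD//; [|exact: integrable_ooM..].
  rewrite El Er -opprD -RintegralD//; last 2 first.
  - by apply: integrable_ooM => //; exact: c1_fun_continuous.
  - by apply: integrable_ooM => //; exact: c1_fun_continuous.
  congr (- _); apply: eq_Rintegral => t _ /=.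
  by rewrite /cutoff -/(r t) -/(l t); ring.
have L1 := Rintegral_cutoff c (integrable_ooM iu cdpsi).
have L2 := Rintegral_cutoff c (integrable_ooM ig cpsi1).
have L3 : \int[mu]_(t in `]a, b[) (u t * psi t * derive1 (cutoff c n) t)
    @[n --> \oo] --> (0 : R).
  apply: (@Rintegral_cutoff_derive a b c (u \* psi)) => //; last by rewrite /= uc0 mul0r.
  move=> x; apply: cvgM; first exact: cu.
  exact: (continuous_subspaceT cpsi1).
have L4 : (- \int[mu]_(t in `]a, b[) (g t * psi t * cutoff c n t)) @[n --> \oo] -->
    \int[mu]_(t in `]a, b[) (u t * derive1 psi t).
  rewrite -(funext H) -[X in _ --> X]addr0; exact: cvgD L1 L3.
by apply: cvg_unique L4 (cvgN L2); exact: norm_hausdorff.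
Qed.

(** Subtracting the constant [u c], whose weak derivative is 0, reduces to a function vanishing at
    [c]; the constant is added back at the end. Constants have the form [0 * t + z] to fit
    [weak_deriv_affine]. *)
Lemma weak_deriv_glue a b c u g : a < c -> c < b ->
  {within `[a, b], continuous u} -> integrable_oo a b g ->
  weak_deriv a c u g -> weak_deriv c b u g -> weak_deriv a b u g.
Proof.
move=> ac cb cu ig wl wr.
have cst_cont x y z : {within `[x, y], continuous (fun t : R => 0 * t + z)}.
  apply: continuous_subspaceT => t.
  by apply: cvgD; [apply: cvgM; [exact: cvg_cst|exact: cvg_id]|exact: cvg_cst].
have icst x y : integrable_oo x y (fun=> 0).
  by apply: continuous_integrable_oo; apply: continuous_subspaceT; exact: cst_continuous.
pose u0 := u \+ (fun t => 0 * t + (- u c)).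
have addcst x y : a <= x -> y <= b -> weak_deriv x y u g -> weak_deriv x y u0 (g \+ cst 0).
  move=> ax yb w; apply: weak_derivD => //; last exact: weak_deriv_affine.
    apply: continuous_subspaceW cu => t; rewrite /= !in_itv /= => /andP[xt ty].
    by rewrite (le_trans ax xt) (le_trans ty yb).
  exact: integrable_oo_sub ig.
have cu0 : {within `[a, b], continuous u0}.
  by move=> x; apply: cvgD; [exact: cu|exact: cst_cont].
have ig0 : integrable_oo a b (g \+ cst 0).
  by apply: eq_integrable ig => // t _; rewrite /= addr0.
have w0 : weak_deriv a b u0 (g \+ cst 0).
  apply: (@weak_deriv_glue0 _ _ c) => //.
  - by rewrite /u0 /= mul0r add0r subrr.
  - by apply: addcst => //; exact: ltW.
  - by apply: addcst => //; exact: ltW.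
have := weak_derivD cu0 (cst_cont a b (u c)) ig0 (icst a b) w0
   (@weak_deriv_affine a b 0 (u c)).
apply: weak_deriv_eq => t _; rewrite /u0 /=; ring.
Qed.

End WeakDerivative.

(** * Translation in time *)

Section Translation.
Context {R : realType}.
Implicit Types (a b s : R) (u g h psi : R -> R).
Notation mu := (@lebesgue_measure R).

Definition translate s : measurableTypeR R -> measurableTypeR R := fun t => t - s.

Lemma measurable_translate s : measurable_fun setT (translate s).
Proof.
by apply: continuous_measurable_fun => t; apply: cvgB; [exact: cvg_id|exact: cvg_cst].
Qed.

HB.instance Definition _ s :=
  isMeasurableFun.Build _ _ _ _ (translate s) (measurable_translate s).

Lemma translate_itv s (b0 b1 : bool) a b :
  translate s @^-1` [set` Interval (BSide b0 a) (BSide b1 b)] =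
  [set` Interval (BSide b0 (a + s)) (BSide b1 (b + s))].
Proof.
apply/seteqP; split=> t; rewrite /translate /= !in_itv /=;
  case: b0; case: b1; rewrite /= ?lerBrDr ?lerBlDr ?ltrBrDr ?ltrBlDr; exact.
Qed.

(** Uniqueness of Lebesgue measure: the pushforward gives every half-open interval its length. *)
Lemma lebesgue_measure_translate s (A : set (measurableTypeR R)) : measurable A ->
  mu (translate s @^-1` A) = mu A.
Proof.
move=> mA; rewrite -[LHS]/(pushforward mu (translate s) A).
apply/esym/lebesgue_measure_unique => //= _ [[x y]] _ <-.
rewrite /pushforward translate_itv !lebesgue_measure_itv /= !lte_fin ltrD2r.
by case: ifP => // _; rewrite -!EFinB; congr EFin; ring.
Qed.

Lemma ae_translate s (P : R -> Prop) :
  {ae mu, forall t, P t} -> {ae mu, forall t, P (t - s)}.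
Proof.
move=> [N [mN N0 PN]]; exists (translate s @^-1` N); split.
- by rewrite -[X in measurable X]setTI; exact: measurable_translate.
- by rewrite lebesgue_measure_translate.
- by move=> t /= nP; apply: PN.
Qed.

Lemma ge0_integral_translate s a b (f : R -> \bar R) :
  measurable_fun `]a, b[ f -> (forall t, 0 <= f t)%E ->
  (\int[mu]_(t in `](a + s)%R, (b + s)%R[) f (t - s)%R = \int[mu]_(t in `]a, b[) f t)%E.
Proof.
move=> mf f0; rewrite -translate_itv.
rewrite -(@ge0_integral_pushforward _ _ _ _ _ _ (measurable_translate s) mu `]a, b[ f)//.
by apply: eq_measure_integral => //= A mA _; exact: lebesgue_measure_translate.
Qed.

Lemma measurable_fun_translate d (T : measurableType d) s a b (f : R -> T) :
  measurable_fun `]a, b[ f -> measurable_fun `]a + s, b + s[ (fun t => f (t - s)).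
Proof.
move=> mf; rewrite -translate_itv.
apply: (@measurable_comp _ _ _ _ _ _ `]a, b[ f _ (translate s)) => //.
  by move=> _ [t ? <-].
exact: measurable_funTS (measurable_translate s).
Qed.

Lemma integrable_oo_translate s a b h : integrable_oo a b h ->
  integrable_oo (a + s) (b + s) (fun t => h (t - s)).
Proof.
move=> /integrableP[mh ih]; apply/integrableP; split.
  exact: (measurable_fun_translate (f := EFin \o h)).
rewrite (@ge0_integral_translate s a b (fun t => `|(EFin \o h) t|%E))//.
exact: measurableT_comp.
Qed.

Lemma Rintegral_translate s a b h : integrable_oo a b h ->
  \int[mu]_(t in `]a + s, b + s[) h (t - s) = \int[mu]_(t in `]a, b[) h t.
Proof.
(* Extension by zero, because the change of variables is applied to a function measurable on the
   whole line. *)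
move=> ih; pose f := (EFin \o h) \_ `]a, b[.
have mh : measurable_fun `]a, b[ (EFin \o h) by case/integrableP: ih.
have mf : measurable_fun setT f by exact/(measurable_restrictT _ _).1.
congr fine; transitivity (\int[mu]_(t in translate s @^-1` `]a, b[) (f \o translate s) t)%E.
  rewrite translate_itv; apply: eq_integral => t.
  by rewrite -translate_itv inE /f => tab; rewrite /= patchE mem_set.
rewrite -(integral_pushforward (measurable_translate s) (mu := mu) mf)//; last first.
  rewrite translate_itv; apply: eq_integrable (integrable_oo_translate s ih) => //.
  move=> t; rewrite -translate_itv inE /f => tab.
  by rewrite /= patchE mem_set.
transitivity (\int[mu]_(t in `]a, b[) f t)%E.
  by apply: eq_measure_integral => //= A mA _; exact: lebesgue_measure_translate.
by apply: eq_integral => t tab; rewrite /f patchE tab.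
Qed.

Lemma weak_deriv_translate s a b u g :
  {within `[a, b], continuous u} -> integrable_oo a b g ->
  weak_deriv a b u g ->
  weak_deriv (a + s) (b + s) (fun t => u (t - s)) (fun t => g (t - s)).
Proof.
move=> cu ig w psi cpsi [a' [b' [aa' bb' psi0]]].
have [cphi dphi] := c1_fun_affine 1 s cpsi; set phi := (X in c1_fun X) in cphi.
have sphi : compact_support a b phi.
  exists (a' - s), (b' - s); split; [by rewrite ltrBrDr|by rewrite ltrBlDr|].
  move=> t tab; apply: psi0 => /andP[t1 t2]; apply: tab.
  by apply/andP; split; lra.
have [_ cdphi] := cphi; have cphi1 := c1_fun_continuous cphi.
have phiE t : psi t = phi (t - s) by rewrite /phi mul1r subrK.
have dphiE t : derive1 psi t = derive1 phi (t - s).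
  by rewrite /phi dphi !mul1r subrK.
under eq_Rintegral do rewrite dphiE.
under [in RHS]eq_Rintegral do rewrite phiE.
have iu := continuous_integrable_oo cu.
rewrite (Rintegral_translate s (integrable_ooM iu cdphi)).
rewrite (Rintegral_translate s (integrable_ooM ig cphi1)).
exact: w.
Qed.

End Translation.

(** * Square-integrable functions *)

Section SquareIntegrable.
Context {R : realType}.
Implicit Types (a b c : R) (X Y Z : normedModType R).
Notation mu := (@lebesgue_measure R).

(** Each fibre is a finite union of intersections of a fibre of [s] with a fibre of [s']. *)
Lemma simple_function_comp2 X Y Z (op : X -> Y -> Z)
    (s : R -> X) (s' : R -> Y) :
  simple_function s -> simple_function s' ->
  simple_function (fun t : R => op (s t) (s' t) : Z).
Proof.
move=> [fs ms] [fs' ms'].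
have fss' : finite_set (range s `*` range s') by exact: finite_setX.
split.
  apply: (@sub_finite_set _ _ ((fun p => op p.1 p.2) @` (range s `*` range s'))).
    by move=> _ [t _ <-]; exists (s t, s' t) => //; split => /=; exists t.
  exact: finite_image.
move=> z; have -> : (fun t : R => op (s t) (s' t)) @^-1` [set z] =
  \bigcup_(p in (range s `*` range s') `&` [set p | op p.1 p.2 = z])
     (s @^-1` [set p.1] `&` s' @^-1` [set p.2]).
  apply/seteqP; split=> [t /= tz|t /= [p [_ pz] [-> ->]] //].
  exists (s t, s' t) => //=; split => //=.
  by split; exists t.
apply: fin_bigcup_measurable.
  by apply: sub_finite_set fss' => p [].
by move=> p _; apply: measurableI.
Qed.

Lemma simple_function_comp X Y (phi : X -> Y) (s : R -> X) :
  simple_function s -> simple_function (phi \o s).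
Proof. by move=> ss; exact: (simple_function_comp2 (fun x _ => phi x) ss ss). Qed.

Lemma simple_function_measurable (s : R -> R) :
  simple_function s -> measurable_fun setT s.
Proof.
move=> [fs ms] _ Y mY; rewrite setTI.
have -> : s @^-1` Y = \bigcup_(x in range s `&` Y) s @^-1` [set x].
  apply/seteqP; split=> [t /= tY|t [x [_ xY] /= ->] //].
  by exists (s t) => //; split => //; exists t.
apply: fin_bigcup_measurable => [|x _]; last exact: ms.
by apply: sub_finite_set fs => p [].
Qed.

Lemma simple_function_cst X (x : X) : simple_function (fun _ : R => x).
Proof.
split; first by apply: sub_finite_set (finite_set1 x) => _ [? _ <-].
move=> z; have [->|xz] := EM (x = z).
  by have -> : (fun _ : R => z) @^-1` [set z] = setT by apply/seteqP; split.
have -> : (fun _ : R => x) @^-1` [set z] = set0 by apply/seteqP; split.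
exact: measurable0.
Qed.

Lemma strongly_measurable_comp2 X Y Z (D : set R) (op : X -> Y -> Z) f (g : R -> Y) :
  continuous (fun p : X * Y => op p.1 p.2) ->
  strongly_measurable D f -> strongly_measurable D g ->
  strongly_measurable D (fun t => op (f t) (g t)).
Proof.
move=> cop [s ss sf] [s' ss' sg].
exists (fun n t => op (s n t) (s' n t)) => [n|t Dt].
  exact: simple_function_comp2.
have cv : (s n t, s' n t) @[n --> \oo] --> (f t, g t).
  by apply: cvg_pair; [exact: sf|exact: sg].
exact: (continuous_cvg _ (cop (f t, g t)) cv).
Qed.

Lemma strongly_measurable_comp X Y (D : set R) (phi : X -> Y) f :
  continuous phi -> strongly_measurable D f -> strongly_measurable D (phi \o f).
Proof.
move=> cphi sf; apply: (strongly_measurable_comp2 (op := fun x _ => phi x) _ sf sf).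
by move=> p; apply: continuous_comp; [exact: cvg_fst|exact: cphi].
Qed.

Lemma strongly_measurableR (D : set (measurableTypeR R)) (f : R -> R) : measurable D ->
  strongly_measurable D f -> measurable_fun D f.
Proof.
move=> mD [s ss sf]; apply: (measurable_fun_cvg (h := s)) => // n.
by apply: measurable_funTS; exact: simple_function_measurable.
Qed.

Lemma strongly_measurable_norm X (D : set (measurableTypeR R)) (f : R -> X) :
  measurable D -> strongly_measurable D f -> measurable_fun D (fun t => `|f t|).
Proof.
move=> mD sf; apply: strongly_measurableR => //.
exact: (strongly_measurable_comp (@norm_continuous _ X)).
Qed.

Lemma strongly_measurable_sub X (D E : set R) (f : R -> X) :
  D `<=` E -> strongly_measurable E f -> strongly_measurable D f.
Proof. by move=> DE [s ss sf]; exists s => // t /DE; exact: sf. Qed.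

Lemma strongly_measurable_translate X (s a b : R) (f : R -> X) :
  strongly_measurable `]a, b[ f ->
  strongly_measurable `]a + s, b + s[ (fun t => f (t - s)).
Proof.
move=> [r sr rf]; exists (fun n t => r n (t - s)) => [n|t].
  have [fr mr] := sr n; split.
    by apply: sub_finite_set fr => _ [t _ <-]; exists (t - s).
  move=> x; have := mr x => /(measurable_translate s measurableT).
  by rewrite setTI.
rewrite /= in_itv /= => /andP[t1 t2]; apply: rf.
by rewrite /= in_itv /= ltrBrDr ltrBlDr t1.
Qed.

Lemma simple_function_if X (P : set (measurableTypeR R)) (s s' : R -> X) :
  measurable P -> simple_function s -> simple_function s' ->
  simple_function (fun t : R => if t \in P then s t else s' t).
Proof.
move=> mP [fs ms] [fs' ms']; split.
  apply: (@sub_finite_set _ _ (range s `|` range s')); last by rewrite finite_setU.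
  by move=> _ [t _ <-]; case: ifP => _; [left|right]; exists t.
move=> x.
have -> : (fun t : R => if t \in P then s t else s' t) @^-1` [set x] =
    (P `&` s @^-1` [set x]) `|` (~` P `&` s' @^-1` [set x]).
  apply/seteqP; split=> t /=.
    by have [tP|tP] := EM (P t); [rewrite mem_set//; left|rewrite memNset//; right].
  by move=> [[tP <-]|[tP <-]]; [rewrite mem_set|rewrite memNset].
by apply: measurableU; apply: measurableI => //; exact: measurableC.
Qed.

(** The two approximating sequences say nothing at [c] itself, so the combined sequence takes the
    constant value [f c] there. *)
Lemma strongly_measurable_glue X a b c (f : R -> X) :
  strongly_measurable `]a, c[ f -> strongly_measurable `]c, b[ f ->
  strongly_measurable `]a, b[ f.
Proof.
move=> [r sr rf] [r' sr' rf'].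
exists (fun n t => if t \in [set` `]-oo, c[] then r n t
  else if t \in [set c] then f c else r' n t) => [n|t].
  apply: (@simple_function_if _ [set` `]-oo, c[] (r n) _ (measurable_itv _)) => //.
  apply: (@simple_function_if _ [set c] _ (r' n) (measurable_set1 _)) => //.
  exact: simple_function_cst.
rewrite /= in_itv /= => /andP[t1 t2].
have [tc|ct|->] := ltgtP t c.
- rewrite mem_set; last by rewrite /= in_itv.
  by apply: rf; rewrite /= in_itv /= t1.
- rewrite memNset; last by rewrite /= in_itv /= ltNge (ltW ct).
  rewrite memNset; last by move=> /= tc; rewrite tc ltxx in ct.
  by apply: rf'; rewrite /= in_itv /= ct.
- rewrite memNset; last by rewrite /= in_itv /= ltxx.
  by rewrite mem_set//; exact: cvg_cst.
Qed.

(** Time rounded down to a grid; the cap [M] leaves finitely many values. Composing any function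
    with it yields a simple function. *)
Lemma simple_function_truncn (M : nat) (x y : R) :
  simple_function (fun t : R => (minn (Num.truncn (x * t + y)) M)%:R : R).
Proof.
set r := fun t : R => x * t + y.
have cr : continuous r.
  by move=> t; apply: cvgD; [apply: cvgM; [exact: cvg_cst|exact: cvg_id]|exact: cvg_cst].
(* Sublevel sets are preimages of half-lines under an affine map; fibres are differences of
   consecutive sublevel sets. *)
have mle k : measurable ([set t | (minn (Num.truncn (r t)) M <= k)%N] : set (measurableTypeR R)).
  have [Mk|kM] := leqP M k.
    have -> : [set t | (minn (Num.truncn (r t)) M <= k)%N] = setT.
      by apply/seteqP; split => // t _ /=; rewrite geq_min Mk orbT.
    exact: measurableT.
  have -> : [set t | (minn (Num.truncn (r t)) M <= k)%N] = r @^-1` [set` `]-oo, k.+1%:R[].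
    by apply/seteqP; split => t /=; rewrite in_itv /= geq_min truncn_le_nat leqNgt kM orbF.
  rewrite -[X in measurable X]setTI.
  by apply: (continuous_measurable_fun cr) => //; exact: measurable_itv.
split.
  apply: (@sub_finite_set _ _ [set k%:R | k in `I_M.+1]); last exact/finite_image/finite_II.
  by move=> _ [t _ <-]; exists (minn (Num.truncn (r t)) M) => //=; rewrite ltnS geq_minr.
move=> z; have [[k <-]|nk] := EM (exists k : nat, k%:R = z); last first.
  have -> : (fun t : R => (minn (Num.truncn (r t)) M)%:R : R) @^-1` [set z] = set0.
    by apply/seteqP; split => // t /= tz; apply: nk; eexists; exact: tz.
  exact: measurable0.
case: k => [|k].
  have -> : (fun t : R => (minn (Num.truncn (r t)) M)%:R : R) @^-1` [set 0%:R] =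
      [set t | (minn (Num.truncn (r t)) M <= 0)%N].
    apply/seteqP; split => t /=; first by move/eqP; rewrite eqr_nat => /eqP ->.
    by rewrite leqn0 => /eqP ->.
  exact: mle.
have -> : (fun t : R => (minn (Num.truncn (r t)) M)%:R : R) @^-1` [set k.+1%:R] =
    [set t | (minn (Num.truncn (r t)) M <= k.+1)%N] `\`
    [set t | (minn (Num.truncn (r t)) M <= k)%N].
  apply/seteqP; split => t /=.
    by move/eqP; rewrite eqr_nat => /eqP ->; split => //; rewrite ltnn.
  move=> [le_k /negP]; rewrite -ltnNge => gt_k; congr (_%:R).
  by apply/eqP; rewrite eqn_leq le_k.
by apply: measurableD.
Qed.

(** [f] is sampled at the last grid point [a + k / (n+1)] before [t], at distance at most 1/(n+1)
    from [t]. The cap [M n] is never active for [t < b]; it serves to make the range finite. *)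
Lemma continuous_strongly_measurable X a b (f : R -> X) :
  {within `[a, b], continuous f} -> strongly_measurable `]a, b[ f.
Proof.
move=> cf.
pose M n := Num.truncn (n.+1%:R * (b - a)).
exists (fun n t => f (a + (minn (Num.truncn (n.+1%:R * t + - (n.+1%:R * a))) (M n))%:R
   / n.+1%:R)) => [n|t tab].
  have sn := simple_function_truncn (M n) n.+1%:R (- (n.+1%:R * a)).
  have := simple_function_comp (fun x : R => f (a + x / n.+1%:R)) sn.
  exact.
have ct : {for t, continuous f}.
  have : {within `]a, b[, continuous f}.
    by apply: continuous_subspaceW cf; exact: subset_itv_oo_cc.
  by rewrite continuous_open_subspace//; apply; rewrite inE.
apply: (continuous_cvg _ ct).
move: tab; rewrite /= in_itv /= => /andP[ta tb].
apply/cvgrPdist_le => e e0; near=> n.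
have N0 : 0 < n.+1%:R :> R by rewrite ltr0n.
have Ne : e^-1 <= n.+1%:R.
  near: n; apply: filterS (nbhs_infty_gtr e^-1) => n /ltW le_n.
  by rewrite (le_trans le_n)// ler_nat.
rewrite -mulrBr (minn_idPl _); last first.
  by apply: le_truncn; rewrite ler_pM2l// lerD2r ltW.
have r0 : 0 <= n.+1%:R * (t - a) by rewrite mulr_ge0// subr_ge0 ltW.
have /andP[k1] := truncn_itv r0; rewrite -[X in _ < X]natr1 [_ + 1]addrC => k2.
set k : R := (Num.truncn _)%:R in k1 k2 *.
have -> : t - (a + k / n.+1%:R) = (n.+1%:R * (t - a) - k) / n.+1%:R.
  by field; rewrite gt_eqF.
rewrite ger0_norm; last by rewrite divr_ge0// subr_ge0.
rewrite ler_pdivrMr//.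
apply: (@le_trans _ _ 1); last by rewrite -ler_pdivrMl// mulr1.
by rewrite lerBlDr /k ltW.
Unshelve. all: by end_near. Qed.

(** The condition [L2] on an arbitrary interval; [L2_oo 0 T] unfolds to [L2 T], and the two are
    interchanged freely below. *)
Definition L2_oo X a b (f : R -> X) :=
  strongly_measurable `]a, b[ f /\
  (\int[mu]_(t in `]a, b[) (`|f t| ^+ 2)%:E < +oo)%E.

Lemma measurable_sqr_norm X a b (f : R -> X) : strongly_measurable `]a, b[ f ->
  measurable_fun `]a, b[ (fun t => (`|f t| ^+ 2)%:E).
Proof.
move=> sf; apply/measurable_EFinP/measurable_funX.
exact: strongly_measurable_norm.
Qed.

Lemma L2_oo_comp2 X Y Z a b (op : X -> Y -> Z) (f : R -> X) (g : R -> Y) (K : R) :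
  continuous (fun p : X * Y => op p.1 p.2) ->
  (forall x y, `|op x y| <= K * (`|x| + `|y|)) ->
  L2_oo a b f -> L2_oo a b g -> L2_oo a b (fun t => op (f t) (g t)).
Proof.
move=> cop opK [mf If] [mg Ig].
have mfg := strongly_measurable_comp2 cop mf mg.
split => //.
have le_sqr t : `|op (f t) (g t)| ^+ 2 <= 2 * K ^+ 2 * (`|f t| ^+ 2 + `|g t| ^+ 2).
  have := opK (f t) (g t); have := normr_ge0 (op (f t) (g t)).
  have := normr_ge0 (f t); have := normr_ge0 (g t).
  move: `|op _ _| `|f t| `|g t| => z x y y0 x0 z0 zK.
  apply: (@le_trans _ _ ((K * (x + y)) ^+ 2)); first by rewrite lerXn2r// nnegrE (le_trans z0).
  rewrite -subr_ge0.
  have -> : 2 * K ^+ 2 * (x ^+ 2 + y ^+ 2) - (K * (x + y)) ^+ 2 = (K * (x - y)) ^+ 2 by ring.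
  exact: sqr_ge0.
apply: (@le_lt_trans _ _ (\int[mu]_(t in `]a, b[)
    ((2 * K ^+ 2)%:E * ((`|f t| ^+ 2)%:E + (`|g t| ^+ 2)%:E)))%E).
  apply: ge0_le_integral => //.
  - exact: measurable_sqr_norm.
  - by apply: measurable_funeM; apply: emeasurable_funD; exact: measurable_sqr_norm.
  - by move=> t _; rewrite -EFinD -EFinM lee_fin.
rewrite ge0_integralZl//; first last.
- by rewrite lee_fin mulr_ge0// sqr_ge0.
- by move=> t _; rewrite -EFinD lee_fin addr_ge0// sqr_ge0.
- by apply: emeasurable_funD; exact: measurable_sqr_norm.
rewrite ge0_integralD//; first last.
- exact: measurable_sqr_norm.
- exact: measurable_sqr_norm.
rewrite lte_mul_pinfty//; first by rewrite lee_fin mulr_ge0// sqr_ge0.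
exact: lte_add_pinfty.
Qed.

Lemma L2_oo_continuous X a b (f : R -> X) :
  {within `[a, b], continuous f} -> L2_oo a b f.
Proof.
move=> cf; have mf := continuous_strongly_measurable cf; split => //.
have : integrable_oo a b (fun t => `|f t| ^+ 2).
  apply: continuous_integrable_oo => t.
  apply: (@continuous_comp _ _ _ (f : subspace `[a, b] -> X) (fun x => `|x| ^+ 2)).
    exact: cf.
  apply: (@continuous_comp _ _ _ (@Num.norm _ X) (fun x : R => x ^+ 2)).
    exact: norm_continuous.
  exact: exprn_continuous.
case/integrableP => _; congr (_ < _)%E; apply: eq_integral => t _.
by rewrite /= ger0_norm// sqr_ge0.
Qed.

Lemma L2_oo_sub X a b a' b' (f : R -> X) : a <= a' -> b' <= b ->
  L2_oo a b f -> L2_oo a' b' f.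
Proof.
move=> aa bb [mf If]; have sub := subset_oo aa bb.
split; first exact: strongly_measurable_sub mf.
apply: le_lt_trans If; apply: ge0_subset_integral => //.
exact: measurable_sqr_norm.
Qed.

Lemma L2_oo_translate X (s a b : R) (f : R -> X) : L2_oo a b f ->
  L2_oo (a + s) (b + s) (fun t => f (t - s)).
Proof.
move=> [mf If]; split; first exact: strongly_measurable_translate.
rewrite (ge0_integral_translate s (f := fun t => (`|f t| ^+ 2)%:E))//.
exact: measurable_sqr_norm.
Qed.

Lemma L2_oo_glue X a b c (f : R -> X) : a < c -> c < b ->
  L2_oo a c f -> L2_oo c b f -> L2_oo a b f.
Proof.
move=> ac cb [mf If] [mg Ig]; have mfg := strongly_measurable_glue mf mg.
split => //.
have abE : [set` `]a, b[] = [set` `]a, c]] `|` [set` `]c, b[] :> set R.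
  by rewrite -itv_bndbnd_setU// bnd_simp ?ltW.
have mab := measurable_sqr_norm mfg.
rewrite abE ge0_integral_setU//; first last.
- apply/disj_setPS => y [/=]; rewrite 2!in_itv/= => /andP[_ yx] /andP[].
  by rewrite ltNge yx.
- by rewrite -abE.
apply: lte_add_pinfty => //.
rewrite -integral_itv_bndo_bndc//; exact: measurable_sqr_norm.
Qed.

Lemma L2_oo_eq X a b (f g : R -> X) : (forall t, a < t < b -> f t = g t) ->
  L2_oo a b f -> L2_oo a b g.
Proof.
move=> fg [[s ss sf] If]; split.
  exists s => // t tab; rewrite -fg; first exact: sf.
  by move: tab; rewrite /= in_itv.
move: If; congr (_ < _)%E; apply: eq_integral => t.
by rewrite inE /= in_itv /= => /fg ->.
Qed.

(** The interval is bounded and |f| <= 1 + |f|^2. *)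
Lemma L2_oo_integrable a b (f : R -> R) : L2_oo a b f -> integrable_oo a b f.
Proof.
move=> [mf If]; have mf' : measurable_fun `]a, b[ f by exact: strongly_measurableR.
have i1 : integrable_oo a b (fun=> 1).
  apply: continuous_integrable_oo; apply: continuous_subspaceT; exact: cst_continuous.
have i2 : integrable_oo a b (fun t => `|f t| ^+ 2).
  apply/integrableP; split; first exact: measurable_sqr_norm.
  by move: If; congr (_ < _)%E; apply: eq_integral => t _; rewrite /= normrX normr_id.
apply: (le_integrable _ _ _ (integrableD _ i1 i2)) => //; first exact/measurable_EFinP.
move=> t _ /=; rewrite lee_fin [leRHS]ger0_norm; last by rewrite addr_ge0.
have := normr_ge0 (f t); move: `|f t| => x; nra.
Qed.

End SquareIntegrable.

(** * Solutions in H *)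

Section WithinContinuity.
Context {R : realType} {X : normedModType R}.
Implicit Types (A : set R) (f g : R -> X).

Lemma within_continuous_eps A f : {within A, continuous f} <->
  forall x, A x -> forall e : R, 0 < e ->
    exists2 d : R, 0 < d & forall t, A t -> `|t - x| < d -> `|f t - f x| < e.
Proof.
rewrite subspace_continuousP; split=> cf x Ax.
  move=> e e0; have /cvgrPdist_lt /(_ _ e0) := cf _ Ax.
  rewrite near_withinE => -[d /= d0 dP]; exists d => // t At td.
  by rewrite distrC; apply: dP => //=; rewrite distrC.
apply/cvgrPdist_lt => e e0; have [d d0 dP] := cf x Ax e e0.
rewrite near_withinE; exists d => //= t td At.
by rewrite distrC; apply: dP => //; rewrite distrC.
Qed.

Lemma within_continuous_eq A f g : (forall t, A t -> f t = g t) ->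
  {within A, continuous f} -> {within A, continuous g}.
Proof.
move=> fg /within_continuous_eps cf; apply/within_continuous_eps => x Ax e e0.
have [d d0 dP] := cf x Ax e e0; exists d => // t At td.
by rewrite -!fg//; exact: dP.
Qed.

Lemma within_continuous_translate f (a b s : R) :
  {within `[a, b], continuous f} ->
  {within `[a + s, b + s], continuous (fun t => f (t - s))}.
Proof.
move=> /within_continuous_eps cf; apply/within_continuous_eps => x xab e e0.
have sab t : [set` `[a + s, b + s]] t -> [set` `[a, b]] (t - s).
  by rewrite /= !in_itv /= lerBrDr lerBlDr.
have [d d0 dP] := cf _ (sab _ xab) e e0; exists d => // t At td.
by apply: dP; [exact: sab|rewrite opprB addrA subrK].
Qed.

Lemma within_continuous_glue f (a b c : R) : a < c -> c < b ->
  {within `[a, c], continuous f} -> {within `[c, b], continuous f} ->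
  {within `[a, b], continuous f}.
Proof.
move=> ac cb /within_continuous_eps cl /within_continuous_eps cr.
apply/within_continuous_eps => x; rewrite /= in_itv /= => /andP[ax xb] e e0.
have [xc|cx|xc] := ltgtP x c.
- have [|d d0 dP] := cl x _ e e0; first by rewrite /= in_itv /= ax ltW.
  exists (Num.min d (c - x)); first by rewrite lt_min d0 subr_gt0.
  move=> t; rewrite /= in_itv /= => /andP[at_ tb]; rewrite lt_min => /andP[td tc].
  apply: dP => //; rewrite /= in_itv /= at_ /=.
  by move: tc; rewrite ltr_norml => /andP[_]; rewrite ltrD2r => /ltW.
- have [|d d0 dP] := cr x _ e e0; first by rewrite /= in_itv /= xb ltW.
  exists (Num.min d (x - c)); first by rewrite lt_min d0 subr_gt0.
  move=> t; rewrite /= in_itv /= => /andP[at_ tb]; rewrite lt_min => /andP[td tc].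
  apply: dP => //; rewrite /= in_itv /= tb andbT.
  by move: tc; rewrite ltr_norml opprB ltrD2r => /andP[/ltW].
have [|d d0 dP] := cl x _ e e0; first by rewrite /= in_itv /= ax xc lexx.
have [|d' d'0 dP'] := cr x _ e e0; first by rewrite /= in_itv /= xb xc lexx.
exists (Num.min d d'); first by rewrite lt_min d0.
move=> t; rewrite /= in_itv /= => /andP[at_ tb]; rewrite lt_min => /andP[td tc].
have [tc'|/ltW tc'] := leP t c.
  by apply: dP => //; rewrite /= in_itv /= at_.
by apply: dP' => //; rewrite /= in_itv /= tb tc'.
Qed.

Lemma within_continuous_sub f (a b a' b' : R) : a <= a' -> b' <= b ->
  {within `[a, b], continuous f} -> {within `[a', b'], continuous f}.
Proof.
move=> aa bb; apply: continuous_subspaceW => t; rewrite /= !in_itv /= => /andP[xt ty].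
by rewrite (le_trans aa xt) (le_trans ty bb).
Qed.

End WithinContinuity.

Section ScalarProduct.
Context {R : realType} {H : normedModType R} (ip : H -> H -> R).
Hypothesis hip : scalar_product ip.

Lemma ipDl x y z : ip (x + y) z = ip x z + ip y z.
Proof. by have [_ L _] := hip; have := L 1 x y z; rewrite scale1r mul1r. Qed.

Lemma ip0l z : ip 0 z = 0.
Proof.
have /eqP := ipDl 0 0 z; rewrite addr0 -subr_eq0 opprD addNKr.
by rewrite oppr_eq0 => /eqP.
Qed.

Lemma ipZl (a : R) x z : ip (a *: x) z = a * ip x z.
Proof. by have [_ L _] := hip; have := L a x 0 z; rewrite addr0 ip0l addr0. Qed.

Lemma ipBl x y z : ip (x - y) z = ip x z - ip y z.
Proof. by rewrite ipDl -scaleN1r ipZl mulN1r. Qed.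

Lemma cauchy_schwarz x y : `|ip x y| <= `|x| * `|y|.
Proof.
have [S _ N] := hip.
have [y0|y0] := eqVneq y 0.
  by rewrite y0 S ip0l !normr0 mulr0.
have n0 : 0 < `|y| ^+ 2 by rewrite exprn_gt0// normr_gt0.
have ipBr u v w : ip u (v - w) = ip u v - ip u w by rewrite S ipBl !(S _ u).
have ipZr (a : R) u v : ip u (a *: v) = a * ip u v by rewrite S ipZl S.
have : 0 <= `|x - (ip x y / `|y| ^+ 2) *: y| ^+ 2 by exact: sqr_ge0.
rewrite N !ipBl !ipBr !ipZl !ipZr -!N (S y x).
set p := ip x y; set n := `|y| ^+ 2 => Q.
have : p ^+ 2 <= `|x| ^+ 2 * n.
  rewrite -ler_pdivrMr//.
  move: Q; suff -> : `|x| ^+ 2 - p / n * p - (p / n * p - p / n * (p / n * n)) =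
    `|x| ^+ 2 - p ^+ 2 / n by rewrite subr_ge0.
  by field; rewrite gt_eqF.
rewrite /n -exprMn -[p ^+ 2]ger0_norm ?sqr_ge0// normrX.
by rewrite ler_sqr ?nnegrE ?mulr_ge0.
Qed.

End ScalarProduct.

Lemma continuous_linear_bound (R : realType) (X Y : normedModType R)
    (f : {linear X -> Y}) : continuous f ->
  exists2 M : R, 0 < M & forall x, `|f x| <= M * `|x|.
Proof.
move=> cf; have /linear_boundedP/pinfty_ex_gt0[M M0 fM] := continuous_linear_bounded 0 (cf 0).
by exists M.
Qed.

#[local] Instance ae_lebesgue_filter (R : realType) :
  Filter (nbhs (almost_everywhere (@lebesgue_measure R))).
Proof. exact: (ae_filter_ringOfSetsType (@lebesgue_measure R)). Qed.

Section Segments.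
Context {R : realType} {H : normedModType R} (ip : H -> H -> R).
Context (Ah : {linear H -> H}).
Hypotheses (hip : scalar_product ip) (cAh : continuous Ah).
Implicit Types (Phi : R -> H -> set H) (y f : R -> H) (a b c s : R).
Notation mu := (@lebesgue_measure R).

(* The equation y' + Ah y = f is tested against constant vectors h only. *)
Definition segment (Phi : H -> set H) a b y f :=
  [/\ {within `[a, b], continuous y}, L2_oo a b f,
      forall h, weak_deriv a b (fun t => ip (y t) h)
        (fun t => ip (f t - Ah (y t)) h)
    & {ae mu, forall t, a < t < b -> Phi (y t) (f t)}].

Let M := sval (cid2 (continuous_linear_bound cAh)).
Let M0 : 0 < M. Proof. by rewrite /M; case: cid2. Qed.
Let AhM x : `|Ah x| <= M * `|x|. Proof. by rewrite /M; case: cid2. Qed.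

Lemma continuous_ip h : continuous (fun x => ip x h).
Proof.
move=> x; apply/cvgrPdist_le => e e0.
have h0 : 0 < `|h| + 1 by rewrite ltr_wpDl.
near=> z; rewrite -ipBl//.
apply: le_trans (cauchy_schwarz hip _ _) _.
have zx : `|x - z| <= e / (`|h| + 1).
  by near: z; apply: cvgr_dist_le; [exact: cvg_id|rewrite divr_gt0].
apply: (@le_trans _ _ (`|x - z| * (`|h| + 1))).
  by rewrite ler_wpM2l// lerDl.
by rewrite -ler_pdivlMr.
Unshelve. all: by end_near. Qed.

Lemma within_continuous_ip a b y h : {within `[a, b], continuous y} ->
  {within `[a, b], continuous (fun t => ip (y t) h)}.
Proof.
move=> cy t; apply: (@continuous_comp _ _ _ (y : subspace `[a, b] -> H) (fun x => ip x h)).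
  exact: cy.
exact: continuous_ip.
Qed.

(** The map [(x, z) |-> ip (x - Ah z) h] has linear growth with constant |h| (1 + M) by
    Cauchy-Schwarz, so the function is square-integrable on a bounded interval. *)
Lemma integrable_rhs a b y f h : {within `[a, b], continuous y} -> L2_oo a b f ->
  integrable_oo a b (fun t => ip (f t - Ah (y t)) h).
Proof.
move=> cy Lf; apply: L2_oo_integrable.
apply: (@L2_oo_comp2 _ _ _ R a b (fun x z => ip (x - Ah z) h) f y (`|h| * (1 + M))) => //.
- move=> p; apply: (@continuous_comp _ _ _ (fun p : H * H => p.1 - Ah p.2) (fun x => ip x h)).
    apply: cvgB; first exact: cvg_fst.
    by apply: (@continuous_comp _ _ _ (fun p : H * H => p.2) Ah); [exact: cvg_snd|exact: cAh].
  exact: continuous_ip.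
- move=> x z; apply: le_trans (cauchy_schwarz hip _ _) _.
  rewrite mulrC -mulrA ler_wpM2l//.
  apply: le_trans (ler_normB _ _) _; rewrite mulrDl mul1r mulrDr.
  have := AhM z; have := normr_ge0 x; have := normr_ge0 z.
  move: M0 `|x| `|z| `|Ah z| => m0 ? ? ?; nra.
- exact: L2_oo_continuous.
Qed.

Lemma segment_eq (Phi : H -> set H) a b y f y' f' :
  (forall t, a <= t <= b -> y t = y' t) -> (forall t, a < t < b -> f t = f' t) ->
  segment Phi a b y f -> segment Phi a b y' f'.
Proof.
move=> yy' ff' [cy Lf w i].
have yy'o t : a < t < b -> y t = y' t.
  by move=> /andP[ta tb]; apply: yy'; rewrite !ltW.
split.
- by apply: within_continuous_eq cy => t; rewrite /= in_itv /=; exact: yy'.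
- exact: L2_oo_eq Lf.
- by move=> h; apply: weak_deriv_eq (w h) => t tab; rewrite yy'o// ff'.
- by apply: filterS i => t tP tab; rewrite -yy'o// -ff'//; exact: tP.
Qed.

Lemma segment_sub (Phi : H -> set H) a b a' b' y f : a <= a' -> b' <= b ->
  segment Phi a b y f -> segment Phi a' b' y f.
Proof.
move=> aa bb [cy Lf w i]; split.
- exact: within_continuous_sub cy.
- exact: L2_oo_sub Lf.
- by move=> h; exact: weak_deriv_sub (w h).
- apply: filterS i => t tP /andP[ta tb]; apply: tP.
  by rewrite (le_lt_trans aa ta) (lt_le_trans tb bb).
Qed.

Lemma segment_translate (Phi : H -> set H) s a b y f : segment Phi a b y f ->
  segment Phi (a + s) (b + s) (fun t => y (t - s)) (fun t => f (t - s)).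
Proof.
move=> [cy Lf w i]; split.
- exact: within_continuous_translate.
- exact: L2_oo_translate.
- move=> h; apply: weak_deriv_translate (w h); first exact: within_continuous_ip.
  exact: integrable_rhs.
- apply: filterS (ae_translate s i) => t tP tab; apply: tP.
  by rewrite ltrBrDr ltrBlDr.
Qed.

Lemma segment_glue (Phi : H -> set H) a b c y f : a < c -> c < b ->
  segment Phi a c y f -> segment Phi c b y f -> segment Phi a b y f.
Proof.
move=> ac cb [cy Lf w i] [cy' Lf' w' i'].
have cyab := within_continuous_glue ac cb cy cy'.
have Lfab := L2_oo_glue ac cb Lf Lf'.
split => //.
- move=> h; apply: (weak_deriv_glue ac cb) => //; first exact: within_continuous_ip.
  exact: integrable_rhs.
(* The junction time lies in neither open interval, but it is a null set. *)
- have ic : {ae mu, forall t, t != c}.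
    exists [set c]; split; [exact: measurable_set1|exact: lebesgue_measure_set1|].
    by move=> t /negP; rewrite negbK => /eqP.
  apply: filterS3 i i' ic => t tP tP' tc /andP[ta tb].
  by case: ltgtP tc => // tc _; [apply: tP|apply: tP']; rewrite ?ta ?tc.
Qed.

(** Adding [(t / tau) *: e] to [y] adds [tau^-1 *: e] to its derivative and [(t / tau) *: Ah e] to
    [Ah y]; the right-hand side must absorb the sum. *)
Lemma segment_perturb (Phi Phi' : H -> set H) (tau : R) (e : H) y f : 0 < tau ->
  (forall t, 0 < t < tau -> Phi (y t) (f t) ->
     Phi' (y t + (t / tau) *: e) (f t + (tau^-1 *: e + (t / tau) *: Ah e))) ->
  segment Phi 0 tau y f ->
  segment Phi' 0 tau (fun t => y t + (t / tau) *: e)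
    (fun t => f t + (tau^-1 *: e + (t / tau) *: Ah e)).
Proof.
move=> tau0 PP' [cy Lf w i].
have cl (x : H) : continuous (fun t : R => (t / tau) *: x).
  move=> t; apply: cvgZ; last exact: cvg_cst.
  by apply: cvgM; [exact: cvg_id|exact: cvg_cst].
have cg : continuous (fun t : R => tau^-1 *: e + (t / tau) *: Ah e).
  by move=> t; apply: cvgD; [exact: cvg_cst|exact: cl].
split.
- by move=> t; apply: cvgD; [exact: cy|exact: (continuous_subspaceT (cl e))].
- apply: (@L2_oo_comp2 _ _ _ H 0 tau (fun x z => x + z) f _ 1) => //.
  + by move=> p; apply: cvgD; [exact: cvg_fst|exact: cvg_snd].
  + by move=> x z; rewrite mul1r; exact: ler_normD.
  + by apply: L2_oo_continuous; exact: continuous_subspaceT.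
- move=> h; have := weak_derivD (within_continuous_ip (h := h) cy) _
    (integrable_rhs h cy Lf) _ (w h) (@weak_deriv_affine _ 0 tau (ip e h / tau) 0).
  have c1 : {within `[0, tau], continuous (fun t => ip e h / tau * t + 0)}.
    apply: continuous_subspaceT => t.
    by apply: cvgD; [apply: cvgM; [exact: cvg_cst|exact: cvg_id]|exact: cvg_cst].
  have i1 : integrable_oo 0 tau (fun=> ip e h / tau).
    by apply: continuous_integrable_oo; apply: continuous_subspaceT; exact: cst_continuous.
  move=> /(_ c1 i1); apply: weak_deriv_eq => t _ /=.
    by rewrite ipDl// ipZl//; ring.
  (* The [Ah e] terms cancel, which leaves the constant derivative of the correction. *)
  have -> : f t + (tau^-1 *: e + (t / tau) *: Ah e) - Ah (y t + (t / tau) *: e) =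
      (f t - Ah (y t)) + tau^-1 *: e.
    by rewrite linearD linearZ /= opprD addrACA addrK.
  by rewrite [RHS]ipDl// ipZl// mulrC.
- by apply: filterS i => t tP tab; apply: PP' => //; exact: tP.
Qed.

End Segments.

(** * Enlarged set-valued maps *)

Section SetDistance.
Context {R : realType} {H : normedModType R}.
Implicit Types (P Q : set H) (r e : R).

(** The slack [e] accounts for an infimum that may not be attained. *)
Lemma dist_leP P Q r : (dist P Q <= r%:E)%E <->
  forall a, P a -> forall e, 0 < e -> exists2 b, Q b & `|a - b| < r + e.
Proof.
split=> [le_r a Pa e e0|le_r].
  have : (ereal_inf [set `|a - b|%:E | b in Q] < (r + e)%:E)%E.
    apply: (@le_lt_trans _ _ r%:E); last by rewrite lte_fin ltrDl.
    by apply: le_trans le_r; apply: ereal_sup_ubound; exists a.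
  by move=> /ereal_inf_lt[_ [b Qb <-]]; rewrite lte_fin; exists b.
apply: ge_ereal_sup => _ [a Pa <-]; apply/lee_addgt0Pr => e e0.
have [b Qb ab] := le_r a Pa e e0.
apply: ge_ereal_inf; exists `|a - b|%:E; first by exists b.
by rewrite -EFinD lee_fin ltW.
Qed.

Lemma dist1_ltP z Q r : (dist [set z] Q < r%:E)%E <-> exists2 b, Q b & `|z - b| < r.
Proof.
rewrite /dist image_set1 ereal_sup1; split=> [/ereal_inf_lt[_ [b Qb <-]]|[b Qb zb]].
  by rewrite lte_fin; exists b.
apply: (@le_lt_trans _ _ `|z - b|%:E); last by rewrite lte_fin.
by apply: ereal_inf_lbound; exists b.
Qed.

Lemma dist_ge0 P Q : P !=set0 -> (0 <= dist P Q)%E.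
Proof.
move=> [a Pa]; apply: (@le_trans _ _ (ereal_inf [set `|a - b|%:E | b in Q])).
  by apply: le_ereal_inf_tmp => _ [b _ <-]; rewrite lee_fin.
by apply: ereal_sup_ubound; exists a.
Qed.

Lemma closure_normP P z : closure P z <-> forall e, 0 < e -> exists2 a, P a & `|z - a| < e.
Proof.
split=> [cz e e0|cz B /nbhs_ballP[e /= e0 eB]].
  have [a [Pa]] := cz _ (nbhsx_ballx z e e0).
  by rewrite -ball_normE; exists a.
have [a Pa za] := cz e e0; exists a; split => //; apply: eB.
by rewrite -ball_normE.
Qed.

Lemma bounded_setP P : bounded_set P <-> exists2 K, 0 < K & forall a, P a -> `|a| <= K.
Proof.
split=> [/pinfty_ex_gt0[K K0 PK]|[K K0 PK]]; first by exists K.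
by exists K; split; [exact: num_real|move=> x /ltW Kx a /PK /le_trans; exact].
Qed.

(** The closure makes the values closed by construction; for closed convex bounded [P] in a Hilbert
    space, closedness of the plain sum would call for weak compactness. *)
Definition enlarge r P : set H :=
  closure [set a + b | a in P & b in [set b : H | `|b| <= r]].

Lemma enlarge_near r P z a : P a -> `|z - a| <= r -> enlarge r P z.
Proof.
move=> Pa za; apply: subset_closure; exists a => //; exists (z - a) => //.
by rewrite addrC subrK.
Qed.

Lemma enlargeP r P z e : 0 < e -> enlarge r P z -> exists2 a, P a & `|z - a| < r + e.
Proof.
move=> e0 /closure_normP/(_ _ e0)[_ [a Pa [b br <-]] zab]; exists a => //.
have -> : z - a = (z - (a + b)) + b by rewrite opprD addrA subrK.
by rewrite (le_lt_trans (ler_normD _ _))// [r + e]addrC ltr_leD.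
Qed.

Lemma enlarge_ccb r P : 0 <= r -> P !=set0 ->
  convex_set (P : set (convex_lmodType H)) -> bounded_set P ->
  [/\ enlarge r P !=set0, closed (enlarge r P),
      convex_set (enlarge r P : set (convex_lmodType H)) & bounded_set (enlarge r P)].
Proof.
move=> r0 [p Pp] cP bP; split.
- by exists p; apply: (enlarge_near Pp); rewrite subrr normr0.
- exact: closed_closure.
- move=> x y l /set_mem Ex /set_mem Ey; apply/mem_set/closure_normP => e e0.
  have /closure_normP/(_ _ e0)[_ [a Pa [b br <-]] xab] := Ex.
  have /closure_normP/(_ _ e0)[_ [a' Pa' [b' br' <-]] yab] := Ey.
  have l0 : 0 <= l%:num by [].
  have [m mE] : exists m, m = 1 - l%:num by exists (1 - l%:num).
  have m0 : 0 <= m by rewrite mE subr_ge0.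
  have ll : l%:num + m = 1 by rewrite mE addrC subrK.
  (* The strict bound needs a positive weight on a strict inequality; if the weight [k] is 0, the
     other one is 1. *)
  have conv_lt u v s : `|u| < s -> `|v| < s -> `|l%:num *: u + m *: v : H| < s.
    move=> us vs; rewrite (le_lt_trans (ler_normD _ _))// !normrZ !ger0_norm//.
    move: (l%:num) l0 ll => k k0 kl.
    move: us vs; move: `|u| `|v| => u' v' us vs.
    have [k1|k1] := ltP 0 k; first by nra.
    have -> : k = 0 by lra.
    have -> : m = 1 by lra.
    lra.
  have conv_le u v s : `|u| <= s -> `|v| <= s -> `|l%:num *: u + m *: v : H| <= s.
    move=> us vs; rewrite (le_trans (ler_normD _ _))// !normrZ !ger0_norm//.
    move: (l%:num) l0 ll => k k0 kl.
    move: us vs; move: `|u| `|v| => u' v' us vs; nra.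
  exists (l%:num *: (a + b) + m *: (a' + b')).
    exists (l%:num *: a + m *: a').
      by rewrite mE; exact: set_mem (cP _ _ l (mem_set Pa) (mem_set Pa')).
    exists (l%:num *: b + m *: b'); first exact: conv_le.
    by rewrite !scalerDr addrACA.
  rewrite -[X in `|X - _|]/(l%:num *: x + (1 - l%:num) *: y) -mE opprD addrACA -!scalerBr.
  exact: conv_lt.
- have /bounded_setP[K K0 PK] := bP; apply/bounded_setP.
  exists (K + (r + 1)) => [|z /(enlargeP ltr01)[a Pa za]]; first by rewrite addr_gt0// ltr_wpDl.
  by rewrite -[z](subrK a) addrC (le_trans (ler_normD _ _))// lerD ?PK// ltW.
Qed.

(** For finite [dist P Q] this is the triangle inequality. The infinite cases are split off: -oo
    occurs for empty [P], whose enlargement is empty too. *)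
Lemma dist_enlarge r P Q : 0 <= r -> (dist (enlarge r P) Q <= dist P Q + r%:E)%E.
Proof.
move=> r0; have [P0|P0] := EM (P !=set0); last first.
  have -> : enlarge r P = set0.
    apply/seteqP; split => // z /(enlargeP ltr01)[a Pa _]; apply: P0; by exists a.
  by rewrite /dist image_set0 ereal_sup0 leNye.
case: (dist P Q) (dist_ge0 Q P0) (@dist_leP P Q) => [d _ dP|_ _|//]; last first.
  by rewrite addye// leey.
rewrite -EFinD; apply/dist_leP => z Ez e e0.
have e2 : 0 < e / 2 by rewrite divr_gt0.
have [a Pa za] := enlargeP e2 Ez.
have [b Qb ab] := (dP d).1 (lexx _) a Pa _ e2.
exists b => //; rewrite -[z - b](subrKA a) (le_lt_trans (ler_normD _ _))//.
by move: za ab; move: `|z - a| `|a - b| => ? ?; lra.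
Qed.

Lemma dist_sub P Q : P `<=` Q -> (dist P Q <= 0)%E.
Proof.
move=> PQ; apply/dist_leP => a /PQ Qa e e0; exists a => //.
by rewrite subrr normr0 add0r.
Qed.

Lemma distH_le P Q r : (distH P Q <= r%:E)%E ->
  (dist P Q <= r%:E)%E /\ (dist Q P <= r%:E)%E.
Proof. by rewrite /distH ge_max => /andP. Qed.

(** Only the base point [a] in [Phi y] is moved to a point [a0] of [Phi y0]; the displacement [b] is
    kept. Of [eps], one half covers the closure, a quarter the Lipschitz bound and a quarter the
    slack of [dist_leP]. *)
Lemma w_usc_enlarge (Phi : H -> set H) r c : 0 < c ->
  (forall y1 y2, (distH (Phi y1) (Phi y2) <= (c * `|y1 - y2|)%:E)%E) ->
  w_usc (fun y => enlarge r (Phi y)).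
Proof.
move=> c0 lip y0 eps eps0; exists (eps / (4 * c)); first by rewrite divr_gt0// mulr_gt0.
move=> y yy0 z Ez; apply/dist1_ltP.
have e2 : 0 < eps / 2 by rewrite divr_gt0.
have e4 : 0 < eps / 4 by rewrite divr_gt0.
have /closure_normP/(_ _ e2)[_ [a Pa [b br <-]] zab] := Ez.
have [/dist_leP/(_ a Pa _ e4)[a0 Pa0 aa0] _] := distH_le (lip y y0).
exists (a0 + b); first by apply: subset_closure; exists a0 => //; exists b.
rewrite -[z - _](subrKA (a + b)) (le_lt_trans (ler_normD _ _))//.
have -> : a + b - (a0 + b) = a - a0 by rewrite opprD addrACA subrr addr0.
have : c * `|y - y0| < eps / 4.
  by move: yy0; rewrite ltr_pdivlMr ?mulr_gt0//; move: `|y - y0| => ?; lra.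
move: zab aa0; move: `|z - _| `|a - _| (c * _) => ? ? ?; lra.
Qed.

(** Points of [Phi y] are compared with the bounded set [Phi 0]. The 2 in the constant collects a
    unit of slack from [enlargeP] and one from [dist_leP]. *)
Lemma linear_growth_enlarge (Phi : H -> set H) r c : 0 < c -> 0 <= r ->
  bounded_set (Phi 0) ->
  (forall y1 y2, (distH (Phi y1) (Phi y2) <= (c * `|y1 - y2|)%:E)%E) ->
  linear_growth (fun y => enlarge r (Phi y)).
Proof.
move=> c0 r0 /bounded_setP[K K0 PK] lip; exists (K + r + 2), c; split => // [|y].
  by rewrite -addrA ltr_wpDr// addr_ge0.
apply: ge_ereal_sup => _ [z /(enlargeP ltr01)[a Pa za] <-]; rewrite lee_fin.
have [/dist_leP/(_ a Pa _ ltr01)[b /PK bK ab] _] := distH_le (lip y 0).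
rewrite subr0 in ab.
have := ler_normD (z - a) (a - b + b); rewrite subrK subrK.
have := ler_normD (a - b) b; rewrite subrK.
move: za ab bK; move: `|z - a| `|a - b| `|b| `|z| `|a| (c * _) => *; lra.
Qed.

End SetDistance.

(** * Joining points by solutions *)

Section Concatenation.
Context {R : realType} {H : normedModType R} (ip : H -> H -> R).
Context (Ah : {linear H -> H}).
Hypotheses (hip : scalar_product ip) (cAh : continuous Ah).

(** Durations of at least 1 bound the speed of a correction and make the junction times of an
    infinite concatenation tend to infinity. *)
Definition reach (Phi : H -> set H) (x x' : H) := exists tau y f,
  [/\ 1 <= tau, y 0 = x, y tau = x' & segment ip Ah Phi 0 tau y f].

Let concat (t1 : R) (y1 y2 : R -> H) t := if t <= t1 then y1 t else y2 (t - t1).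

Lemma reach_trans Phi : forall x1 x2 x3,
  reach Phi x1 x2 -> reach Phi x2 x3 -> reach Phi x1 x3.
Proof.
move=> x1 x2 x3 [t1 [y1 [f1 [t1_ge1 y10 y1t s1]]]] [t2 [y2 [f2 [t2_ge1 y20 y2t s2]]]].
have t10 : 0 < t1 by lra.
have t20 : 0 < t2 by lra.
exists (t2 + t1), (concat t1 y1 y2), (concat t1 f1 f2); split.
- lra.
- by rewrite /concat ltW.
- by rewrite /concat ifF ?addrK//; apply/negbTE; rewrite -ltNge ltrDr.
apply: (segment_glue hip cAh t10); first by rewrite ltrDr.
  apply: segment_eq s1 => t /andP[_ tt]; first by rewrite /concat tt.
  by rewrite /concat ltW.
have := segment_translate hip cAh t1 s2; rewrite add0r.
apply: segment_eq => t /andP[tt _]; last by rewrite /concat leNgt tt.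
rewrite /concat; case: ifPn => // tt'.
have -> : t = t1 by apply/eqP; rewrite eq_le tt tt'.
by rewrite subrr y20 y1t.
Qed.

Lemma reach_sequence Phi (d : nat -> H) : (forall k, reach Phi (d k) (d k.+1)) ->
  exists (y f : R -> H) (s : nat -> R),
    [/\ s 0%N = 0, forall k, s k + 1 <= s k.+1, forall k, y (s k) = d k
      & forall k, segment ip Ah Phi 0 (s k.+1) y f].
Proof.
move=> dr; have /choice[D DP] : forall k, exists p : R * (R -> H) * (R -> H),
    [/\ 1 <= p.1.1, p.1.2 0 = d k, p.1.2 p.1.1 = d k.+1
      & segment ip Ah Phi 0 p.1.1 p.1.2 p.2].
  by move=> k; have [t [y [f P]]] := dr k; exists (t, y, f).
pose tau k := (D k).1.1; pose s k : R := \sum_(i < k) tau i.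
have sS k : s k.+1 = s k + tau k by rewrite /s big_ord_recr.
have tau1 k : 1 <= tau k by have [] := DP k.
have s1 k : s k + 1 <= s k.+1 by rewrite sS lerD2l.
have s_le : {homo s : k l / (k <= l)%N >-> k <= l}.
  by apply: homo_leq => [//|? ? ?|k]; [exact: le_trans|have := s1 k; lra].
(* The index of the piece containing [t]; half-open pieces make it unambiguous, and the default 0 is
   met only for negative [t]. *)
pose idx t := xget 0%N [set k | s k <= t < s k.+1].
have idxE k t : s k <= t < s k.+1 -> idx t = k.
  move=> kt; rewrite /idx; case: xgetP => [l _ lt|/(_ k)/(_ kt)//].
  apply/eqP; rewrite eqn_leq; apply/andP; split; rewrite leqNgt; apply/negP => /s_le;
    move: kt lt => /andP[k1 k2] /andP[l1 l2]; lra.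
pose y t := (D (idx t)).1.2 (t - s (idx t)).
pose f t := (D (idx t)).2 (t - s (idx t)).
have ys k : y (s k) = d k.
  rewrite /y (idxE k) ?subrr; first by have [] := DP k.
  by rewrite lexx /=; have := s1 k; lra.
have seg k : segment ip Ah Phi (s k) (s k.+1) y f.
  have [_ D0 Dt sk] := DP k.
  have := segment_translate hip cAh (s k) sk.
  rewrite add0r [_ + s k]addrC -/(tau k) -sS.
  apply: segment_eq => t /andP[kt tk]; last by rewrite /f (idxE k)// ltW.
  (* The right end belongs to the next piece, whose initial value is the final value of this one. *)
  have [tk'|tk'] := ltP t (s k.+1); first by rewrite /y (idxE k)// kt.
  have -> : t = s k.+1 by apply/eqP; rewrite eq_le tk tk'.
  by rewrite ys {1}sS addrC addKr Dt.
exists y, f, s; split => //; first by rewrite /s big_ord0.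
elim=> [|k IHk].
  by have := seg 0%N; rewrite {1}/s big_ord0.
apply: (segment_glue hip cAh _ _ IHk (seg _)).
- have : s 0%N <= s k by exact: s_le.
  by rewrite {1}/s big_ord0; have := s1 k; lra.
- by have := s1 k.+1; lra.
Qed.

(* Correcting the last jump linearly in time costs at most a multiple of its size
   in the right-hand side, which the Lipschitz bound lets [enlarge] absorb. *)
Lemma reach_perturb (F G : H -> set H) (c r : R) :
  0 < c -> 0 < r -> (forall z : H, F z `<=` G z) ->
  (forall y1 y2, (distH (G y1) (G y2) <= (c * `|y1 - y2|)%:E)%E) ->
  exists2 eps : R, 0 < eps & forall tau y f x, 1 <= tau ->
    segment ip Ah F 0 tau y f -> `|x - y tau| < eps ->
    reach (fun z : H => enlarge r (G z)) (y 0) x.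
Proof.
move=> c0 r0 FG lip; have [M M0 AhM] := continuous_linear_bound cAh.
(* In the sum [c + 1 + M], [c] pays for moving the argument of [G], 1 for [tau^-1 *: e] (as
   [tau >= 1]) and [M] for [(t / tau) *: Ah e]. They use up [r / 2]; the other half is the slack of
   [dist_leP]. *)
pose eps := r / (2 * (c + 1 + M)).
have K0 : 0 < c + 1 + M by rewrite !addr_gt0.
have eps0 : 0 < eps by rewrite divr_gt0// mulr_gt0.
have epsE : (c + 1 + M) * eps = r / 2 by rewrite /eps; field; rewrite gt_eqF.
exists eps => // tau y f x tau1 sy xy.
have tau0 : 0 < tau by lra.
set e := x - y tau in xy.
exists tau, (fun t => y t + (t / tau) *: e),
  (fun t => f t + (tau^-1 *: e + (t / tau) *: Ah e)); split => //.
- by rewrite mul0r scale0r addr0.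
- by rewrite divff ?gt_eqF// scale1r /e addrC subrK.
apply: (segment_perturb hip cAh tau0 _ sy) => t /andP[t0 tt] /FG Gf.
have t1 : 0 <= t / tau <= 1.
  apply/andP; split; first by rewrite divr_ge0// ltW.
  by rewrite ler_pdivrMr// mul1r ltW.
have /andP[u0 u1] := t1.
have r2 : 0 < r / 2 by rewrite divr_gt0.
have [/dist_leP/(_ _ Gf _ r2)[a Ga fa] _] := distH_le (lip (y t) (y t + (t / tau) *: e)).
apply: (enlarge_near Ga).
have le1 : c * `|y t - (y t + (t / tau) *: e)| <= c * eps.
  rewrite ler_pM2l// opprD addNKr normrN normrZ ger0_norm//.
  by rewrite -[leRHS]mul1r ler_pM// ltW.
have le2 : `|tau^-1 *: e| <= eps.
  have v0 : 0 <= tau^-1 by rewrite invr_ge0 ltW.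
  have v1 : tau^-1 <= 1 by rewrite invf_le1.
  by rewrite normrZ ger0_norm// -[leRHS]mul1r ler_pM// ltW.
have le3 : `|(t / tau) *: Ah e| <= M * eps.
  rewrite normrZ ger0_norm// -[leRHS]mul1r ler_pM//.
  by rewrite (le_trans (AhM _))// ler_pM2l// ltW.
have -> : f t + (tau^-1 *: e + (t / tau) *: Ah e) - a =
    (f t - a) + (tau^-1 *: e + (t / tau) *: Ah e) by rewrite addrAC.
apply: le_trans (ler_normD _ _) _.
have := ler_normD (tau^-1 *: e) ((t / tau) *: Ah e).
move: fa le1 le2 le3 epsE.
move: `|f t - a| `|_ + _| `|_ *: e| `|_ *: Ah e| (c * `|_|) => p q p1 p2 p3; lra.
Qed.

End Concatenation.

(** * Compact connected sets *)

Section CompactSets.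
Context {R : realType} {H : normedModType R}.
Implicit Types (B : set H).

(** The points related to [x] form a nonempty subset of B that is relatively open and closed: any
    point of B within [e] of it already belongs to it. *)
Lemma connected_near_rel B (rel : H -> H -> Prop) (e : R) : connected B -> 0 < e ->
  (forall x y z, rel x y -> rel y z -> rel x z) ->
  (forall x z, B x -> B z -> `|x - z| < e -> rel x z) ->
  forall x z, B x -> B z -> rel x z.
Proof.
move=> cB e0 trans near_rel x z Bx Bz.
pose C := [set w | B w /\ rel x w].
have near_C w w' : C w -> B w' -> `|w - w'| < e -> C w'.
  by move=> [Bw xw] Bw' ww'; split => //; exact: trans xw (near_rel _ _ Bw Bw' ww').
have C0 : C !=set0.
  by exists x; split => //; apply: near_rel => //; rewrite subrr normr0.
suff CB : C = B by have [] : C z by rewrite CB.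
apply: cB C0 _ _.
  exists (\bigcup_(w in C) ball w e).
    by apply: bigcup_open => w _; exact: ball_open.
  apply/seteqP; split=> [w Cw|w [Bw [w' Cw']]].
    by split; [case: Cw|exists w => //; exact: ballxx].
  by rewrite -ball_normE => /(near_C _ _ Cw' Bw).
exists (closure C); first exact: closed_closure.
apply/seteqP; split=> [w Cw|w [Bw]].
  by split; [case: Cw|exact: subset_closure].
by move/closure_normP/(_ _ e0) => [w' Cw' ww']; apply: (near_C w') => //; rewrite distrC.
Qed.

Lemma compact_net B (e : R) : compact B -> 0 < e ->
  exists s : seq H, (forall x, x \in s -> B x) /\
    forall z, B z -> exists2 x, x \in s & `|x - z| < e.
Proof.
rewrite compact_cover => cB e0.
have [|z Bz|D' D'B Bcov] := cB H B (fun x => ball x e).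
- by move=> x _; exact: ball_open.
- by exists z => //; exact: ballxx.
exists (finmap.enum_fset D'); split=> [x xD|z /Bcov[x xD]].
  exact: set_mem (D'B _ xD).
by rewrite -ball_normE; exists x.
Qed.

(* Writing k = 2 ^ n (2 m + 1), the k-th term is the m-th point of a 1/(n+1)-net,
   so the nets of all scales are visited at arbitrarily late indices. *)
Lemma compact_cluster_sequence B y0 : compact B -> B y0 ->
  exists d : nat -> H, [/\ d 0%N = y0, forall k, B (d k)
    & forall z, B z -> forall n, exists2 k, (n <= k)%N & `|d k - z| < n.+1%:R^-1].
Proof.
move=> cB By0.
have /choice[net netP] : forall n : nat, exists s : seq H, (forall x, x \in s -> B x) /\
    forall z, B z -> exists2 x, x \in s & `|x - z| < n.+1%:R^-1.
  by move=> n; apply: compact_net => //; rewrite invr_gt0.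
(* Index 0 is reserved for the start [y0]. Halving the odd part 2m + 1 of k gives m, and indices
   beyond the end of a net return [y0], which also lies in B. *)
pose d k := if k == 0%N then y0 else
  nth y0 (net (logn 2 k)) (k %/ 2 ^ logn 2 k)./2.
exists d; split => // [k|z Bz n].
  rewrite /d; case: ifP => // _; set s := net _; set m := (_./2).
  have [ms|sm] := ltnP m (size s); last by rewrite nth_default.
  by have [netB _] := netP (logn 2 k); apply/netB/mem_nth.
have [_ /(_ z Bz)[x xs xz]] := netP n.
pose m := index x (net n); pose k := (2 ^ n * m.*2.+1)%N.
have k0 : (0 < k)%N by rewrite muln_gt0 expn_gt0.
have kn : logn 2 k = n.
  rewrite /k lognM ?expn_gt0// pfactorK// [X in (_ + X)%N](_ : _ = 0%N) ?addn0//.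
  by apply: logn_coprime; rewrite coprime2n /= odd_double.
exists k.
  by rewrite (leq_trans (ltnW (ltn_expl n (ltnSn 1))))// leq_pmulr.
rewrite /d gtn_eqF// kn /k mulKn ?expn_gt0// -[_./2]/(uphalf m.*2) uphalf_double.
by rewrite nth_index.
Qed.

End CompactSets.

(** * Mild solutions as solutions in H *)

Section GelfandTriple.
Context {R : realType} {V H V' : completeNormedModType R}.
Context (ip : H -> H -> R) (pair : V' -> V -> R).
Context (j : {linear V -> H}) (i : {linear H -> V'}) (A : {linear V -> V'}).
Context (Ah : {linear H -> H}).
Hypotheses (htriple : gelfand_triple ip pair j i) (cAh : continuous Ah).
Hypothesis AhE : forall u, i (Ah (j u)) = A u.
Notation mu := (@lebesgue_measure R).

Let hip : scalar_product ip. Proof. by case: htriple. Qed.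
Let pair_i h v : pair (i h) v = ip h (j v). Proof. by case: htriple. Qed.
Let cj : continuous j. Proof. by case: htriple => _ _ []. Qed.
Let ci : continuous i. Proof. by case: htriple => _ _ _ []. Qed.

(* Coercivity of [A] on V and its boundedness on H make the two norms equivalent,
   so that [j] is onto. *)
Lemma embedding_inverse (lambda : R) : 0 < lambda ->
  (forall u : V, lambda * `|u| ^+ 2 <= pair (A u) u) ->
  exists2 g : H -> V, continuous g & cancel g j.
Proof.
move=> l0 coercive; have [M M0 AhM] := continuous_linear_bound cAh.
(* Coercivity gives |u|^2 <= (M / lambda) |j u|^2; since M / lambda <= K^2, this [K] avoids a square
   root. *)
pose K := 1 + M / lambda.
have Ml0 : 0 < M / lambda by rewrite divr_gt0.
have K0 : 0 < K by rewrite addr_gt0.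
have jK u : `|u| <= K * `|j u|.
  have := coercive u; rewrite -AhE pair_i => /le_trans.
  move=> /(_ _ (ler_norm _)) /le_trans /(_ (cauchy_schwarz hip _ _)) uAh.
  have : lambda * `|u| ^+ 2 <= M * `|j u| * `|j u|.
    by apply: le_trans uAh _; rewrite ler_wpM2r.
  rewrite mulrC -ler_pdivlMr// -[M * _ * _]mulrA mulrAC => u2.
  rewrite -(@ler_pXn2r _ 2)// ?nnegrE ?mulr_ge0 ?(ltW K0)// exprMn.
  apply: le_trans u2 _; rewrite -expr2 ler_wpM2r ?sqr_ge0// /K; nra.
(* By density some [j (u n)] converge to [x]; the norm bound [jK] makes [u n] Cauchy in the complete
   space V, and the limit is a preimage. *)
have jV x : exists u, j u = x.
  have [_ _ [_ _ dj _] _ _] := htriple.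
  have /choice[u uP] : forall n : nat, exists u, `|j u - x| < n.+1%:R^-1.
    move=> n; have n0 : 0 < n.+1%:R^-1 :> R by rewrite invr_gt0.
    have [w [xw [u _ ju]]] := dj (ball x n.+1%:R^-1) (ex_intro _ x (ballxx x n0))
      (ball_open x _).
    by exists u; move: xw; rewrite -ju -ball_normE /= distrC.
  have inv_small (e : R) : 0 < e -> \forall n \near \oo, n.+1%:R^-1 < e.
    move=> e0; apply: filterS (nbhs_infty_gtr e^-1) => n ne.
    rewrite invf_plt ?posrE//; apply: (lt_le_trans ne); by rewrite ler_nat.
  have /cauchy_cvg cu : cauchy (u n @[n --> \oo]).
    apply: cauchy_exP => e e0.
    have e2 : 0 < e / (2 * K) by rewrite divr_gt0// mulr_gt0.
    have [N _ NP] := inv_small _ e2.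
    exists (u N); exists N => // n /= Nn; rewrite -ball_normE /=.
    apply: le_lt_trans (jK _) _; rewrite linearB /=.
    have uN := lt_trans (uP N) (NP N (leqnn N)).
    have un := lt_trans (uP n) (NP n Nn).
    rewrite -ltr_pdivlMl// -[j (u N) - _](subrKA x) (le_lt_trans (ler_normD _ _))//.
    rewrite [`|x - _|]distrC.
    have -> : K^-1 * e = e / (2 * K) + e / (2 * K) by field; rewrite gt_eqF.
    exact: ltrD.
  exists (lim (u n @[n --> \oo])).
  have c1 : j (u n) @[n --> \oo] --> j (lim (u n @[n --> \oo])).
    by apply: (cvg_comp u j cu); exact: cj.
  apply: cvg_unique c1 _; first exact: norm_hausdorff.
  apply/cvgrPdist_lt => e e0; near=> n; rewrite distrC.
  by apply: lt_trans (uP n) _; near: n; exact: inv_small.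
have /choice[g gK] := jV; exists g => //.
move=> x; apply/cvgrPdist_lt => e e0; near=> z.
apply: le_lt_trans (jK _) _; rewrite linearB /= !gK -ltr_pdivlMl//.
by near: z; apply: cvgr_dist_lt; [exact: cvg_id|rewrite mulr_gt0 ?invr_gt0].
Unshelve. all: by end_near. Qed.

Context (g : H -> V).
Hypotheses (cg : continuous g) (gK : cancel g j).

Lemma pairBl f f' v : pair (f - f') v = pair f v - pair f' v.
Proof.
have [_ [[L _] _ _] _ _ _] := htriple.
by have := L (-1) f' f v; rewrite scaleN1r mulN1r addrC => ->; rewrite addrC.
Qed.

(** The dual norm bounds the pairing at [v / (|v| + 1)], a point of the unit ball; the 1 covers
    [v = 0]. *)
Lemma continuous_pair v : continuous (fun f => pair f v).
Proof.
have [_ [[Ll Lr] N _] _ _ _] := htriple.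
have pair0 f : pair f 0 = 0.
  have /eqP := Lr f 1 0 0; rewrite scale1r mul1r addr0 -subr_eq0 opprD addNKr.
  by rewrite oppr_eq0 => /eqP.
have pair_bound f : `|pair f v| <= (`|v| + 1) * `|f|.
  have v1 : 0 < `|v| + 1 by rewrite ltr_wpDl.
  rewrite -ler_pdivrMl//.
  have := Lr f (`|v| + 1)^-1 v 0; rewrite addr0 pair0 addr0 => E.
  rewrite -[(_ + 1)^-1]ger0_norm ?invr_ge0 ?(ltW v1)// -normrM -E -lee_fin N.
  apply: ereal_sup_ubound; exists ((`|v| + 1)^-1 *: v) => //=.
  by rewrite normrZ ger0_norm ?invr_ge0 ?(ltW v1)// ler_pdivrMl// mulr1 lerDl.
move=> f; apply/cvgrPdist_le => e e0; near=> f'.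
rewrite -pairBl; apply: le_trans (pair_bound _) _.
rewrite -ler_pdivlMl; last by rewrite ltr_wpDl.
near: f'; apply: cvgr_dist_le; first exact: cvg_id.
by rewrite mulr_gt0// invr_gt0 ltr_wpDl.
Unshelve. all: by end_near. Qed.

(** Testing the V'-valued equation against [g h], for which [j (g h) = h], gives the equation in H
    tested against h. Almost everywhere [dy = i (f - Ah y)], because [A v = i (Ah (j v))]. *)
Lemma mild_solution_segment Phi y0 y (tau : R) : 0 < tau ->
  mild_solution pair j i A Phi y0 y -> exists f, segment ip Ah Phi 0 tau y f.
Proof.
move=> tau0 [cy sol _].
have [v [dy [f [[Lv yv] [Ldy w] Lf dyE fP]]]] := sol _ tau0.
have cy' : {within `[0, tau], continuous y}.
  by apply: continuous_subspaceW cy => t; rewrite /= !in_itv /= andbT => /andP[].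
exists f; split => // h psi cpsi spsi.
have [a [b [a0 bT psi0]]] := spsi.
have test : test_function tau psi.
  have [dpsi cdpsi] := cpsi; split => //.
  (* [test_function] asks for bounds in strict order, unlike [compact_support]; the interval is
     widened to contain the middle third. *)
  exists (Num.min a (tau / 3)), (Num.max b (2 * tau / 3)); split.
  - by rewrite lt_min a0 divr_gt0.
  - by rewrite gt_min; apply/orP; right; rewrite lt_max; apply/orP; right; lra.
  - by rewrite gt_max bT; lra.
  - move=> t nt; apply: psi0 => /andP[at_ tb]; apply: nt.
    by rewrite ge_min at_ le_max tb.
have := w psi test (g h).
under eq_Rintegral do rewrite /= pair_i gK.
move=> ->; congr (- _); rewrite /Rintegral; congr fine.
have mpsi : measurable_fun `]0, tau[ psi.
  exact: measurable_funTS (continuous_measurable_fun (c1_fun_continuous cpsi)).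
apply: ae_eq_integral.
- exact: measurable_itv.
- apply/measurable_EFinP/measurable_funM => //.
  case: Ldy => sdy _.
  have := strongly_measurable_comp (@continuous_pair (g h)) sdy.
  by move/(strongly_measurableR (measurable_itv _)).
- apply/measurable_EFinP/measurable_funM => //.
  by have /integrableP[/measurable_EFinP] := integrable_rhs hip cAh h cy' Lf.
- apply: filterS2 yv dyE => t yv dyE /=; rewrite in_itv /= => tT.
  congr (_ * _)%:E; rewrite -[h in RHS]gK -pair_i; congr pair.
  by rewrite linearB /= yv// AhE -dyE// addrK.
Qed.

(** The V-valued representative is [g \o y], continuous because [g] is, and the derivative is
    [i (f - Ah y)]; testing it against [v] is testing in H against [j v]. *)
Lemma segment_mild_solution Phi y f :
  (forall T, 0 < T -> segment ip Ah Phi 0 T y f) ->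
  mild_solution pair j i A Phi (y 0) y.
Proof.
move=> seg; split => //.
  apply/within_continuous_eps => x; rewrite /= in_itv /= andbT => x0 e e0.
  have x1 : 0 < x + 1 by rewrite ltr_wpDl.
  have [/within_continuous_eps cy _ _ _] := seg _ x1.
  have [|d d0 dP] := cy x _ e e0; first by rewrite /= in_itv /= x0 lerDl ler01.
  exists (Num.min d 1); first by rewrite lt_min d0 ltr01.
  move=> t; rewrite /= in_itv /= andbT lt_min => t0 /andP[td t1].
  apply: dP => //; rewrite /= in_itv /= t0 /=.
  by move: t1; rewrite ltr_norml => /andP[_]; rewrite ltrBlDl => /ltW; rewrite addrC.
move=> T T0; have [cy Lf w fP] := seg _ T0.
have [Mi Mi0 iM] := continuous_linear_bound ci.
have [M M0 AhM] := continuous_linear_bound cAh.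
exists (g \o y), (fun t => i (f t - Ah (y t))), f; split => //.
- split; last by apply: aeW => t _; rewrite /= gK.
  apply: L2_oo_continuous => t.
  by apply: (@continuous_comp _ _ _ (y : subspace `[0, T] -> H) g); [exact: cy|exact: cg].
- split.
    apply: (@L2_oo_comp2 _ _ _ V' 0 T (fun x z => i (x - Ah z)) f y (Mi * (1 + M))) => //.
    + move=> p; apply: (@continuous_comp _ _ _ (fun p : H * H => p.1 - Ah p.2) i).
        apply: cvgB; first exact: cvg_fst.
        by apply: (@continuous_comp _ _ _ (fun p : H * H => p.2) Ah); [exact: cvg_snd|exact: cAh].
      exact: ci.
    + move=> x z; apply: le_trans (iM _) _; rewrite -mulrA ler_pM2l//.
      apply: le_trans (ler_normB _ _) _; rewrite mulrDl mul1r mulrDr.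
      have := AhM z; have := normr_ge0 x; have := normr_ge0 z.
      move: M0 `|x| `|z| `|Ah z| => m0 ? ? ?; nra.
    + exact: L2_oo_continuous.
  move=> psi [dpsi cdpsi [a [b [a0 ab bT psi0]]]] v.
  have := w (j v) psi (conj dpsi cdpsi); under eq_Rintegral do rewrite -pair_i.
  move=> ->; last by exists a, b.
  by congr (- _); apply: eq_Rintegral => t _; rewrite pair_i.
- by apply: aeW => t _ /=; rewrite linearB -AhE gK subrK.
Qed.

End GelfandTriple.

(** * Conclusion *)

(** Every jump of the chain is below [eps / 2], so the last one can be redirected from [z] to [z']
    while staying below [eps]; the other chain points are hit exactly. *)
Lemma reach_chain (R : realType) (H : normedModType R) (ip : H -> H -> R)
    (Ah : {linear H -> H}) (Phi : H -> set H) (G : R -> H -> set H) (B : set H)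
    (eps : R) (x z z' : H) :
  scalar_product ip -> continuous Ah -> 0 < eps ->
  (forall tau x x', 1 <= tau -> (dist [set x'] (G tau x) < eps%:E)%E ->
     reach ip Ah Phi x x') ->
  chain G B (eps / 2) 1 x z -> `|z - z'| < eps / 2 -> reach ip Ah Phi x z'.
Proof.
move=> hip cAh eps0 step [n [y [t [n0 [<- <-] _ tP]]]] zz'.
have jump k : (k.+1 < n)%N -> reach ip Ah Phi (y k) (y k.+1).
  move=> /ltnW/tP[t1 /dist1_ltP[b Gb yb]]; apply: step t1 _.
  by apply/dist1_ltP; exists b => //; lra.
have before k : (k.+1 < n)%N -> reach ip Ah Phi (y 0%N) (y k.+1).
  elim: k => [|k IHk] kn; first exact: jump.
  exact: (reach_trans hip cAh (IHk (ltnW kn)) (jump _ kn)).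
have last : reach ip Ah Phi (y n.-1) z'.
  have [] := tP n.-1; first by rewrite prednK.
  rewrite prednK// => t1 /dist1_ltP[b Gb yb]; apply: step t1 _.
  apply/dist1_ltP; exists b => //; rewrite -[z' - b](subrKA (y n)).
  apply: le_lt_trans (ler_normD _ _) _.
  by rewrite -[X in _ < X]/eps [`|z' - _|]distrC [eps]splitr ltrD.
case: n n0 zz' tP jump before last => [//|[//|n]] _ _ _ _ before last.
exact: (reach_trans hip cAh (before n (ltnSn _)) last).
Qed.

Theorem theorem10 (R : realType) (V H V' : completeNormedModType R)
    (ip : H -> H -> R) (pair : V' -> V -> R)
    (j : {linear V -> H}) (i : {linear H -> V'})
    (htriple : gelfand_triple ip pair j i)
    (A : {linear V -> V'}) (hAcont : continuous A)
    (hAsym : forall u v, pair (A u) v = pair (A v) u)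
    (lambda1 lambda2 : R) (hlambda : 0 < lambda1 < lambda2)
    (hAbound : forall u : V,
       lambda1 * `|u| ^+ 2 <= pair (A u) u <= lambda2 * `|u| ^+ 2)
    (F : H -> set H)
    (hFval : ccb_values F) (hFusc : w_usc F) (hFgrowth : linear_growth F)
    (F_ : nat -> H -> set H)
    (hF_val : forall N, (1 <= N)%N -> ccb_values (F_ N))
    (hF_sub : forall N, (1 <= N)%N -> forall y, F y `<=` F_ N y)
    (hF_cvg : forall y, dist (F_ N y) (F y) @[N --> \oo] --> 0%E)
    (hF_lip : exists c : nat -> R, forall N, (1 <= N)%N -> 0 < c N /\
       forall y1 y2, (distH (F_ N y1) (F_ N y2) <= (c N * `|y1 - y2|)%:E)%E)
    (B : set H) (hBcompact : compact B) (hBconnected : connected B)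
    (hBinv : quasi_invariant (mild_solutions pair j i A F) B)
    (hBchain : chain_recurrent (semiflow (mild_solutions pair j i A F)) B)
    (hAH : bounded_in_H j i A) :
  exists Fs : nat -> H -> set H,
    [/\ forall N, (1 <= N)%N ->
          [/\ ccb_values (Fs N), w_usc (Fs N) & linear_growth (Fs N)],
        forall y, distH (Fs N y) (F y) @[N --> \oo] --> 0%E
      & forall y0, B y0 -> forall N, (1 <= N)%N ->
          exists2 y : R -> H, mild_solution pair j i A (Fs N) y0 y
                            & B `<=` omega_limit y].
Proof.
have [hip _ _ _ _] := htriple; have [Ah cAh AhE] := hAH.
have [l0 _] := andP hlambda.
have [g cg gK] := embedding_inverse htriple cAh AhE l0
  (fun u => (andP (hAbound u)).1).
have [c cP] := hF_lip.
pose r (N : nat) : R := N.+1%:R^-1.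
have r0 N : 0 < r N by rewrite invr_gt0.
exists (fun N y => enlarge (r N) (F_ N y)); split.
- move=> N N1; have [cN0 lip] := cP N N1; split.
  + by move=> y; have [? _ ? ?] := hF_val N N1 y; apply: enlarge_ccb => //; exact: ltW.
  + exact: w_usc_enlarge lip.
  + have [_ _ _ ?] := hF_val N N1 0.
    by apply: linear_growth_enlarge lip => //; exact: ltW.
- move=> y; have [Fy0 _ _ _] := hFval y.
  (* Since [F y] lies in the enlarged value, one half of [distH] is at most 0 and [dist_enlarge]
     bounds the other. *)
  apply: (@squeeze_cvge _ _ _ _ (cst 0%E) _
    (fun N => dist (F_ N y) (F y) + (r N)%:E)%E).
  + near=> N; have N1 : (1 <= N)%N by near: N; exact: nbhs_infty_ge.
    have FsubE : F y `<=` enlarge (r N) (F_ N y).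
      move=> z /(hF_sub N N1) Fz; apply: (enlarge_near Fz).
      by rewrite subrr normr0 ltW.
    have [FN0 _ _ _] := hF_val N N1 y.
    rewrite /distH le_max ge_max; apply/andP; split.
      by apply/orP; left; apply: dist_ge0; have [z /FsubE] := Fy0; exists z.
    rewrite dist_enlarge ?(ltW (r0 N))//=.
    apply: le_trans (dist_sub FsubE) _.
    by rewrite adde_ge0 ?dist_ge0// lee_fin ltW.
  + exact: cvg_cst.
  + rewrite -[X in _ --> X]adde0; apply: cvgeD => //.
    by apply: cvg_EFin; [exact: nearW|exact: cvg_harmonic].
- move=> y0 By0 N N1; have [cN0 lip] := cP N N1.
  pose Phi := fun y : H => enlarge (r N) (F_ N y).
  have [eps eps0 step] := reach_perturb hip cAh cN0 (r0 N) (hF_sub N N1) lip.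
  have step' tau x x' : 1 <= tau ->
      (dist [set x'] (semiflow (mild_solutions pair j i A F) tau x) < eps%:E)%E ->
      reach ip Ah Phi x x'.
    move=> tau1 /dist1_ltP[_ [phi [[w mphi] phi0] <-]] xphi.
    have tau0 : 0 < tau by lra.
    have [f sf] := mild_solution_segment htriple cAh AhE gK tau0 mphi.
    by rewrite -phi0; exact: step tau1 sf xphi.
  have e2 : 0 < eps / 2 by rewrite divr_gt0.
  have reachB : forall x z, B x -> B z -> reach ip Ah Phi x z.
    apply: (connected_near_rel hBconnected e2).
      by move=> x1 x2 x3; exact: reach_trans.
    move=> x z Bx Bz xz.
    (* The chain runs from [x] back to [x]; its endpoint is then redirected to [z]. *)
    exact: (reach_chain hip cAh eps0 step' (hBchain _ Bx _ _ e2 ltr01) xz).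
  have [d [d0 Bd dcl]] := compact_cluster_sequence hBcompact By0.
  have [y [f [s [s0 s1 ys seg]]]] := reach_sequence hip cAh
    (fun k => reachB _ _ (Bd k) (Bd k.+1)).
  (* This covers every bounded time interval by finitely many pieces and sends the junction times to
     infinity. *)
  have s_ge k : k%:R <= s k.
    by elim: k => [|k IHk]; [rewrite s0|rewrite -natr1; have := s1 k; lra].
  exists y.
    have <- : y 0 = y0 by rewrite -s0 ys.
    apply: (segment_mild_solution htriple cAh AhE cg gK) => T T0.
    apply: segment_sub (seg (Num.truncn T)) => //.
    by apply: le_trans (s_ge _); exact/ltW/truncnS_gt.
  move=> z /dcl zcl.
  have /choice[k kP] : forall n, exists k, (n <= k)%N /\ `|d k - z| < n.+1%:R^-1.
    by move=> n; have [k] := zcl n; exists k.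
  exists (s \o k).
    apply/cvgryPge => K; near=> n.
    apply: (@le_trans _ _ n%:R); first by near: n; exact: nbhs_infty_ger.
    by apply: le_trans (s_ge _); rewrite ler_nat; have [] := kP n.
  apply/cvgrPdist_lt => e e0; near=> n; rewrite /= ys distrC.
  have [_ /lt_trans] := kP n; apply; near: n.
  apply: filterS (nbhs_infty_gtr e^-1) => n ne.
  by rewrite invf_plt ?posrE//; apply: (lt_le_trans ne); rewrite ler_nat.
Unshelve. all: by end_near. Qed.
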